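(* Let $m\ge2$ and let $\Omega$ be a bounded domain in $\mathbb{R}^{2m}$ with coordinates $(x_1,y_1,\dots,x_m,y_m)$. Let $\vec F=(-y_1,x_1,-y_2,x_2,\dots,-y_m,x_m)$. For $w\in C^1(\Omega)$ let $S(w)=\{p\in\Omega:(\nabla w+\vec F)(p)=0\}$ and on $\Omega\setminus S(w)$ let $N(w)=(\nabla w+\vec F)/|\nabla w+\vec F|$. Let $u,v\in C^{2}(\Omega)\cap C^{0}(\bar\Omega)$ and $S=S(u)\cup S(v)$. Suppose $\operatorname{div}N(u)\ge\operatorname{div}N(v)$ in $\Omega\setminus S$ and $u\le v$ on $\partial\Omega$. Then $u\le v$ in $\Omega$.
   Context: $\nabla$ and $\operatorname{div}$ are the Euclidean gradient and divergence in $\mathbb{R}^{2m}$. *)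

(* Defs.v *)
From HB Require Import structures.
From mathcomp Require Import all_boot all_order all_algebra.
From mathcomp Require Import all_classical all_reals all_analysis.
Set Implicit Arguments. Unset Strict Implicit. Unset Printing Implicit Defensive.
Import Order.TTheory GRing.Theory Num.Theory.
Import numFieldNormedType.Exports.
Local Open Scope classical_set_scope.
Local Open Scope ring_scope.

Section Defs.
Variables (R : realType) (n : nat).
Notation V := 'rV[R]_n.

Definition ebasis (i : 'I_n) : V := delta_mx 0 i.

Definition partial (w : V -> R) (i : 'I_n) (p : V) : R := derive w p (ebasis i).

Definition grad (w : V -> R) (p : V) : V := \row_i partial w i p.

Definition div (X : V -> V) (p : V) : R := \sum_i partial (fun q => X q 0 i) i p.

(* Euclidean norm (the library's norm on 'rV is the sup norm) *)
Definition enorm (v : V) : R := Num.sqrt (\sum_i v 0 i ^+ 2).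

Definition C1_on (O : set V) (w : V -> R) : Prop :=
  (forall p, O p -> {for p, continuous w}) /\
  forall i, (forall p, O p -> derivable w p (ebasis i)) /\
            (forall p, O p -> {for p, continuous (partial w i)}).

Definition C2_on (O : set V) (w : V -> R) : Prop :=
  C1_on O w /\ forall i, C1_on O (partial w i).
End Defs.

(* coordinates (x_1,y_1,...,x_m,y_m): index 2k <-> x_{k+1}, 2k+1 <-> y_{k+1};
   partner swaps 2k <-> 2k+1 *)
Definition partner (n : nat) (i : 'I_n) : 'I_n :=
  odflt i (insub (if odd i then i.-1 else i.+1)%N).

Section Heis.
Variables (R : realType) (m : nat).
Notation V := 'rV[R]_(2 * m).

Definition Fvec (p : V) : V :=
  \row_i (if odd i then p 0 (partner i) else - p 0 (partner i)).

Definition Sing (w : V -> R) : set V := [set p | grad w p + Fvec p = 0].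

(* N(w) = (grad w + F)/|grad w + F| (meaningful off S(w)) *)
Definition Nfield (w : V -> R) (p : V) : V :=
  (enorm (grad w p + Fvec p))^-1 *: (grad w p + Fvec p).
End Heis.

(* Main.v *)
(** Write [G w = grad w + F], so that [curl F] is a constant nondegenerate form,
    and suppose [w = u - v] is positive somewhere. Testing the inequality
    [div N(u) >= div N(v)] against [eta * max (w - tau, 0) ^ 2], where [eta] is a
    cutoff vanishing near the singular set, gives
    [(N(u) - N(v)) . (G u - G v) = 0], hence [G u] and [G v] are parallel on
    [{w > 0}]. The cutoff is harmless because the Jacobian of [G w] has rank at
    least 2 (its antisymmetric part is nondegenerate and [m >= 2]), so that
    [{|G w| < eps}] has volume [O(eps ^ 2)] while [|grad eta| = O(1 / eps)].
    Differentiating [G v /\ grad w = 0] gives [curl F /\ grad w = 0], hence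
    [grad w = 0] on [{w > 0}], again because [m >= 2]; since [w <= 0] on the
    boundary this is absurd.

    All integrals are replaced by sums over the grid of mesh [2 L / N] in the
    box [[-L, L]^n], with an error that vanishes as [N] tends to infinity. *)
Require Import Defs.
From HB Require Import structures.
From mathcomp Require Import all_boot all_order all_algebra.
From mathcomp Require Import all_classical all_reals all_analysis.
From mathcomp Require Import ring lra zify.
Set Implicit Arguments.
Unset Strict Implicit.
Import Order.TTheory GRing.Theory Num.Theory.
Import numFieldNormedType.Exports.
Local Open Scope classical_set_scope.
Local Open Scope ring_scope.

(** * C1 functions and their partial derivatives *)

(** Two limits compete: the cutoff error is only [O(eps)] once the mesh is fine compared with [eps].
    So the constants (the bound on [eps * |grad eta|], the count of grid points divided by
    [eps ^ 2], the density of a box) are all fixed before [eps], and [N] is taken large last.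

    Since [u] and [v] are C2 only inside the domain, everything happens on [{w >= tau}] with
    [tau > 0], which is compact inside it because [w <= 0] on the boundary. Squaring the positive
    part, and building the cutoffs from [|G|^2], which unlike [|G|] is C1 at zeros of [G], make the
    test field C1 on the whole space; pointwise partial derivatives and the mean value theorem then
    suffice.

    Parallelism is kept as equations between products of components. These hold trivially where
    [G u] or [G v] vanishes, so they can be differentiated on all of [{w > 0}], singular points
    included. *)

Section C1.
Context {R : realType} {n : nat}.
Notation V := 'rV[R]_n.
Implicit Types (f g : V -> R) (O : set V) (p x : V) (i j : 'I_n).

Lemma nbhs_box p (A : set V) : nbhs p A ->
  exists2 r : R, 0 < r & forall x, (forall i, `|x 0 i - p 0 i| < r) -> A x.
Proof.
move=> /nbhs_ballP[r /= r0 rA]; exists r => // x xr; apply: rA.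
by split=> // i j; rewrite ord1 /ball/= distrC.
Qed.

Lemma box_nbhs p (r : R) : 0 < r ->
  nbhs p [set x | forall i, `|x 0 i - p 0 i| < r].
Proof.
move=> r0; apply/nbhs_ballP; exists r => //= x [_ xr] i.
by rewrite distrC; exact: xr.
Qed.

Lemma coord_line x i (t : R) j :
  (x + t *: ebasis R i) 0 j = x 0 j + t * (j == i)%:R.
Proof. by rewrite !mxE eqxx. Qed.

Lemma coord_line_near x i (t : R) j : `|(x + t *: ebasis R i) 0 j - x 0 j| <= `|t|.
Proof.
rewrite coord_line addrAC subrr add0r.
by case: eqP => _; rewrite ?mulr1 ?mulr0 ?normr0.
Qed.

Lemma continuous_near_eq {T U : topologicalType} (f g : T -> U) (p : T) :
  (\near p, f p = g p) -> {for p, continuous f} -> {for p, continuous g}.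
Proof.
move=> fg cf; rewrite /prop_for /continuous_at -(nbhs_singleton fg).
exact: cvg_trans (near_eq_cvg fg) cf.
Qed.

Lemma line_is_derive f i x (t : R) : derivable f (x + t *: ebasis R i) (ebasis R i) ->
  is_derive t 1 (fun t => f (x + t *: ebasis R i)) (partial f i (x + t *: ebasis R i)).
Proof.
rewrite /partial /derivable /derive => df.
have E : (fun h => h^-1 *: (((fun t => f (x + t *: ebasis R i)) \o shift t) (h *: 1) -
   f (x + t *: ebasis R i))) = (fun h =>
    h^-1 *: ((f \o shift (x + t *: ebasis R i)) (h *: ebasis R i) - f (x + t *: ebasis R i))).
  apply/funext => h /=; do 3 f_equal.
  by rewrite [h *: 1]mulr1 addrCA scalerDl.
split; first by rewrite /derivable E.
by rewrite /derive E.
Qed.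

(** The step [s] may have either sign, as differences of grid points do. *)
Lemma partial_MVT f i x (s : R) :
  (forall t : R, `|t| <= `|s| -> derivable f (x + t *: ebasis R i) (ebasis R i)) ->
  exists2 t : R, `|t| <= `|s| &
    f (x + s *: ebasis R i) - f x = s * partial f i (x + t *: ebasis R i).
Proof.
move=> df; pose g t := f (x + t *: ebasis R i).
have dg (t : R) : `|t| <= `|s| -> is_derive t 1 g (partial f i (x + t *: ebasis R i)).
  by move=> /df; exact: line_is_derive.
have cg (a b : R) : (forall t : R, t \in `[a, b] -> `|t| <= `|s|) -> {within `[a, b], continuous g}.
  move=> H; apply: derivable_within_continuous => t /H /dg ?; exact: ex_derive.
have g0 : g 0 = f x by rewrite /g scale0r addr0.
have [s0|s0] := leP 0 s.
- have H (t : R) : t \in `[0, s] -> `|t| <= `|s|.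
    by rewrite in_itv/= => /andP[t0 ts]; rewrite !ger0_norm.
  have [|t tI E] := @MVT_segment R g (fun t => partial f i (x + t *: ebasis R i)) 0 s s0 _ (cg _ _ H).
    by move=> t tI; apply/dg/H; exact: subset_itv_oo_cc.
  by exists t; [exact: H|rewrite -/(g s) -g0 E subr0 mulrC].
- have H (t : R) : t \in `[s, 0] -> `|t| <= `|s|.
    by rewrite in_itv/= => /andP[t0 ts]; rewrite !ler0_norm// ?lerN2// ltW.
  have [|t tI E] := @MVT_segment R g (fun t => partial f i (x + t *: ebasis R i)) s 0 (ltW s0) _ (cg _ _ H).
    by move=> t tI; apply/dg/H; exact: subset_itv_oo_cc.
  exists t; first exact: H.
  by rewrite -/(g s) -g0 -opprB E sub0r mulrN opprK mulrC.
Qed.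

(** As [O] is open, [partial f i] agrees with the candidate [df i] near each point of [O] and
    inherits its continuity. *)
Lemma C1_on_intro O f (df : 'I_n -> V -> R) : open O ->
  (forall p, O p -> {for p, continuous f}) ->
  (forall i p, O p -> is_derive p (ebasis R i) f (df i p)) ->
  (forall i p, O p -> {for p, continuous (df i)}) -> C1_on O f.
Proof.
move=> oO cf dfE cdf; split => // i; split=> [p /(dfE i) ?|p Op].
  exact: ex_derive.
apply: (@continuous_near_eq _ _ (df i)); last exact: cdf.
have Op' : nbhs p O by exact: open_nbhs_nbhs.
near=> q; apply/esym/(@derive_val _ _ _ _ _ _ _ (dfE i q _)).
by near: q.
Unshelve. all: by end_near. Qed.

Lemma C1_derive O f i p : C1_on O f -> O p -> is_derive p (ebasis R i) f (partial f i p).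
Proof. by move=> [_ /(_ i)[df _]] /df; exact: derivableP. Qed.

Lemma C1_cont O f p : C1_on O f -> O p -> {for p, continuous f}.
Proof. by case=> c _; exact: c. Qed.

Lemma C1_dcont O f i p : C1_on O f -> O p -> {for p, continuous (partial f i)}.
Proof. by case=> _ /(_ i)[_]; exact. Qed.

Lemma C1_sub O O' f : O' `<=` O -> C1_on O f -> C1_on O' f.
Proof.
move=> s [c d]; split=> [p /s|i]; first exact: c.
by have [d1 d2] := d i; split=> p /s; [exact: d1|exact: d2].
Qed.

(** [C1_on] constrains each point separately, through its neighbourhoods in the whole space, so
    gluing is free. This is how the test field becomes C1 everywhere. *)
Lemma C1_setU O O' f : C1_on O f -> C1_on O' f -> C1_on (O `|` O') f.
Proof.
move=> [c d] [c' d']; split=> [p [/c|/c']//|i].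
have [d1 d2] := d i; have [d1' d2'] := d' i.
by split=> p []; auto.
Qed.

Lemma C1_eq O f g : open O -> {in O, f =1 g} -> C1_on O f -> C1_on O g.
Proof.
move=> oO fg Cf; have nfg p : O p -> \near p, f p = g p.
  by move=> Op; near=> q; apply: fg; rewrite inE; near: q; exact: open_nbhs_nbhs.
apply: (@C1_on_intro _ _ (partial f)) => // [p Op|i p Op|i p Op].
- exact: continuous_near_eq (nfg p Op) (C1_cont Cf Op).
- exact: near_eq_is_derive (nfg p Op) (C1_derive i Cf Op).
- exact: C1_dcont Cf Op.
Unshelve. all: by end_near. Qed.

Lemma is_derive_partial f i p d : is_derive p (ebasis R i) f d -> partial f i p = d.
Proof. by move=> ?; exact: derive_val. Qed.

Lemma C1_cst O (c : R) : open O -> C1_on O (fun=> c).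
Proof.
move=> oO; apply: (@C1_on_intro _ _ (fun _ _ => 0)) => // *; exact: cst_continuous.
Qed.

Lemma C1_D O f g : open O -> C1_on O f -> C1_on O g -> C1_on O (fun x => f x + g x).
Proof.
move=> oO Cf Cg; apply: (@C1_on_intro _ _ (fun i x => partial f i x + partial g i x)) => //.
- by move=> p Op; apply: continuousD; [exact: C1_cont Cf Op|exact: C1_cont Cg Op].
- by move=> i p Op; apply: is_deriveD; [exact (C1_derive i Cf Op)|exact (C1_derive i Cg Op)].
- by move=> i p Op; apply: continuousD; [exact: C1_dcont Cf Op|exact: C1_dcont Cg Op].
Qed.

Lemma C1_M O f g : open O -> C1_on O f -> C1_on O g -> C1_on O (fun x => f x * g x).
Proof.
move=> oO Cf Cg.
apply: (@C1_on_intro _ _ (fun i x => f x * partial g i x + g x * partial f i x)) => //.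
- by move=> p Op; apply: continuousM; [exact: C1_cont Cf Op|exact: C1_cont Cg Op].
- by move=> i p Op; apply: is_deriveM; [exact (C1_derive i Cf Op)|exact (C1_derive i Cg Op)].
- move=> i p Op; have cf := C1_cont Cf Op; have cg := C1_cont Cg Op.
  have df := C1_dcont (i:=i) Cf Op; have dg := C1_dcont (i:=i) Cg Op.
  by apply: (@continuousD R R^o V); apply: continuousM.
Qed.

Lemma partialD O f g i p : C1_on O f -> C1_on O g -> O p ->
  partial (fun x => f x + g x) i p = partial f i p + partial g i p.
Proof.
by move=> Cf Cg Op; apply/is_derive_partial/is_deriveD; [exact (C1_derive i Cf Op)|exact (C1_derive i Cg Op)].
Qed.

Lemma partialM O f g i p : C1_on O f -> C1_on O g -> O p ->
  partial (fun x => f x * g x) i p = f p * partial g i p + g p * partial f i p.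
Proof.
by move=> Cf Cg Op; apply/is_derive_partial/is_deriveM; [exact (C1_derive i Cf Op)|exact (C1_derive i Cg Op)].
Qed.

Lemma C1_N O f : open O -> C1_on O f -> C1_on O (fun x => - f x).
Proof.
move=> oO Cf; have /= := C1_M oO (C1_cst (-1) oO) Cf.
by apply: C1_eq => // x _; rewrite mulN1r.
Qed.

Lemma C1_B O f g : open O -> C1_on O f -> C1_on O g -> C1_on O (fun x => f x - g x).
Proof. by move=> oO Cf Cg; exact (C1_D oO Cf (C1_N oO Cg)). Qed.

Lemma partialB O f g i p : C1_on O f -> C1_on O g -> O p ->
  partial (fun x => f x - g x) i p = partial f i p - partial g i p.
Proof.
by move=> Cf Cg Op; apply/is_derive_partial/is_deriveB; [exact (C1_derive i Cf Op)|exact (C1_derive i Cg Op)].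
Qed.

Lemma C1_sum O (I : Type) (r : seq I) (F : I -> V -> R) : open O ->
  (forall k, C1_on O (F k)) -> C1_on O (fun x => \sum_(k <- r) F k x).
Proof.
move=> oO CF; elim: r => [|k r IH].
  by apply: (C1_eq oO _ (C1_cst 0 oO)) => x _; rewrite big_nil.
by apply: (C1_eq oO _ (C1_D oO (CF k) IH)) => x _; rewrite big_cons.
Qed.

Lemma partial_near f g i p : (\near p, f p = g p) -> partial f i p = partial g i p.
Proof. exact: near_eq_derive. Qed.

Lemma partial_sum O (I : Type) (r : seq I) (F : I -> V -> R) i p : open O ->
  (forall k, C1_on O (F k)) -> O p ->
  partial (fun x => \sum_(k <- r) F k x) i p = \sum_(k <- r) partial (F k) i p.
Proof.
move=> oO CF Op; elim: r => [|k r IH].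
  rewrite big_nil (@partial_near _ (fun=> 0)); last by near=> x; rewrite big_nil.
  exact: derive_cst.
rewrite big_cons -IH (@partial_near _ (fun x => F k x + \sum_(k <- r) F k x)).
  by rewrite (@partialD O) //; exact: C1_sum.
by near=> x; rewrite big_cons.
Unshelve. all: by end_near. Qed.

(** Only a directional derivative of [f] is given, so the one-variable chain rule is applied on the
    line through [p] in direction [i]. *)
Lemma is_derive_scomp f i p (h : R -> R) (d : R) : derivable f p (ebasis R i) ->
  is_derive (f p) 1 h d -> is_derive p (ebasis R i) (h \o f) (d * partial f i p).
Proof.
move=> dfp dh.
have p0 : p = p + 0 *: ebasis R i by rewrite scale0r addr0.
have /line_is_derive D : derivable f (p + 0 *: ebasis R i) (ebasis R i) by rewrite -p0.
have dh0 : derivable h ((fun t => f (p + t *: ebasis R i)) 0) 1 by rewrite /= -p0.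
have := derive1_comp (@ex_derive _ _ _ _ _ _ _ D) dh0; rewrite !derive1E.
rewrite (@derive_val _ _ _ _ _ _ _ D) -p0 (@derive_val _ _ _ _ _ _ _ dh) => E.
have dd : derivable (h \o (fun t => f (p + t *: ebasis R i))) 0 1.
  by apply/derivable1_diffP/differentiable_comp; apply/derivable1_diffP => //; exact: (@ex_derive _ _ _ _ _ _ _ D).
have EE : (fun k => k^-1 *: (((h \o (fun t => f (p + t *: ebasis R i))) \o shift 0) (k *: 1) -
   (h \o (fun t => f (p + t *: ebasis R i))) 0)) = (fun k =>
    k^-1 *: (((h \o f) \o shift p) (k *: ebasis R i) - (h \o f) p)).
  apply/funext => k /=; rewrite -p0; do 4 f_equal.
  by rewrite [k *: 1]mulr1 addr0 addrC.
split; first by move: dd; rewrite /derivable EE.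
by rewrite -E /derive EE.
Qed.

Lemma C1_comp O f (h h' : R -> R) : open O -> C1_on O f ->
  (forall p, O p -> is_derive (f p) 1 h (h' (f p))) ->
  (forall p, O p -> {for f p, continuous h'}) -> C1_on O (fun x => h (f x)).
Proof.
move=> oO Cf dh ch.
apply: (@C1_on_intro _ _ (fun i x => h' (f x) * partial f i x)) => //.
- move=> p Op; apply: (@continuous_comp _ _ _ f h); first exact: C1_cont Cf Op.
  by apply/differentiable_continuous/derivable1_diffP; have ? := dh p Op; exact: ex_derive.
- by move=> i p Op; apply: is_derive_scomp (dh p Op); have := C1_derive i Cf Op; case.
- move=> i p Op; apply: continuousM; last exact: C1_dcont Cf Op.
  by apply: (@continuous_comp _ _ _ f h'); [exact: C1_cont Cf Op|exact: ch].
Qed.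

Lemma partial_comp O f (h : R -> R) d i p : C1_on O f -> O p ->
  is_derive (f p) 1 h d -> partial (fun x => h (f x)) i p = d * partial f i p.
Proof.
by move=> Cf Op dh; apply/is_derive_partial/is_derive_scomp => //; have := C1_derive i Cf Op; case.
Qed.

End C1.

(** * Sums over a grid *)

(** Compactness as an induction principle, in place of finite subcovers. If [Q K] failed, the sets
    [A] with [Q (K]\[A)] would form a proper filter, and [Q] could not hold locally at its cluster
    point. *)
Lemma compact_ind {T : topologicalType} (K : set T) (Q : set T -> Prop) :
  compact K -> (forall A B, A `<=` B -> Q B -> Q A) -> Q set0 ->
  (forall A B, Q A -> Q B -> Q (A `|` B)) ->
  (forall x, K x -> exists2 U, nbhs x U & Q U) -> Q K.
Proof.
move=> cK Qs Q0 QU Qloc; apply: contrapT => nQK.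
pose F : set (set T) := [set A | Q (K `\` A)].
have FF : Filter F.
  split => [|A B FA FB|A B AB]; rewrite /F /=.
  - by rewrite setDT.
  - by rewrite setDIr; exact: QU.
  - by apply: Qs; exact: setDS.
have PF : ProperFilter F.
  by split => //; rewrite /F/= setD0.
have [|x [Kx clx]] := cK F PF; first by rewrite /F/= setDv.
have [U Ux QU'] := Qloc x Kx.
have FU : F (~` U) by rewrite /F/= setDE setCK; apply: Qs QU'; exact: subIsetr.
by have [y []] := clx _ _ FU Ux.
Qed.

Section grid.
Context {R : realType} {n : nat}.
Notation V := 'rV[R]_n.
Implicit Types (f g : V -> R) (p x : V) (i j : 'I_n) (N : nat) (L : R).

(** The face at [+ L] is left out, so the [N.+1] points of an axis form one period and can be
    shifted cyclically. *)
Definition gridpt L N (k : {ffun 'I_n -> 'I_N.+1}) : V :=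
  \row_i (- L + 2 * L / N.+1%:R * (k i)%:R).

Lemma gridpt_bound L N (k : {ffun 'I_n -> 'I_N.+1}) i : 0 <= L ->
  `|gridpt L k 0 i| <= L.
Proof.
move=> L0; rewrite !mxE.
have k0 : 0 <= (k i)%:R / N.+1%:R :> R by [].
have k1 : (k i)%:R / N.+1%:R <= 1 :> R by rewrite ler_pdivrMr// mul1r ler_nat ltnW.
have -> : 2 * L / N.+1%:R * (k i)%:R = 2 * L * ((k i)%:R / N.+1%:R) by rewrite mulrAC mulrA.
set c := _ / _ in k0 k1 *.
have Lc : 0 <= L * c by rewrite mulr_ge0.
have Lc1 : L * c <= L by rewrite ler_piMr.
by rewrite ler_norml; apply/andP; split; lra.
Qed.

(** Shifting permutes the grid cyclically, except that the last layer moves to the face [+ L]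
    instead of the face [- L]; [f] vanishes on both. *)
Lemma sum_grid_shift f L N i : (forall x, `|x 0 i| = L -> f x = 0) -> 0 <= L ->
  \sum_(k : {ffun 'I_n -> 'I_N.+1}) f (gridpt L k + (2 * L / N.+1%:R) *: ebasis R i) =
  \sum_(k : {ffun 'I_n -> 'I_N.+1}) f (gridpt L k).
Proof.
move=> f0 L0.
pose sh (s : 'I_N.+1 -> 'I_N.+1) (k : {ffun 'I_n -> 'I_N.+1}) : {ffun 'I_n -> 'I_N.+1} :=
  [ffun j => if j == i then s (k j) else k j].
have shK (s s' : 'I_N.+1 -> 'I_N.+1) : cancel s s' -> cancel (sh s) (sh s').
  by move=> ss' k; apply/ffunP => j; rewrite !ffunE; case: eqP => // _; rewrite ss'.
rewrite [RHS](reindex (sh (@ordS _))) /=; last first.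
  by apply: onW_bij; exists (sh (@ord_pred _)); apply: shK; [exact: ordSK|exact: ord_predK].
apply: eq_bigr => k _.
have [kN|kN] := ltnP (k i).+1 N.+1.
  congr f; apply/rowP => j; rewrite !mxE eqxx !ffunE.
  case: eqP => [->|_] /=; last by rewrite mulr0 addr0.
  by rewrite modn_small// mulr1 -addrA -[(k i).+1%:R]natr1 mulrDr mulr1.
have {}kN : k i = N :> nat by apply/eqP; rewrite eqn_leq -ltnS ltn_ord.
rewrite !f0//.
  by rewrite mxE ffunE eqxx /= kN modnn mulr0 addr0 normrN ger0_norm.
rewrite coord_line !mxE eqxx mulr1 kN -addrA -[X in _ + (_ + X)]mulr1 -mulrDr natr1.
by rewrite divfK ?pnatr_eq0// -[X in `|X|]/(- L + 2 * L) (_ : - L + 2 * L = L) ?ger0_norm//; ring.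
Qed.

(* The difference quotients of [f] have zero sum since [f] vanishes on the faces
   of the box, and they are uniformly close to the partial derivatives. *)
Lemma sum_grid_partial f L i (d : R) : 0 < L -> 0 < d ->
  (forall x, derivable f x (ebasis R i)) -> continuous (partial f i) ->
  (forall x, L <= `|x 0 i| -> f x = 0) ->
  \forall N \near \oo,
    `|\sum_(k : {ffun 'I_n -> 'I_N.+1}) partial f i (gridpt L k)| <= d * N.+1%:R ^+ n.
Proof.
move=> L0 d0 df cf f0.
have cB : compact [set x : V | forall j, x 0 j \in `[- L, L]].
  by apply: (@rV_compact _ _ (fun=> `[- L, L]%classic)) => _; exact: segment_compact.
have := (@compact_near_coveringP _ _).1 cB nat \oo (fun N x => forall t : R,
  `|t| <= 2 * L / N.+1%:R ->
  `|partial f i (x + t *: ebasis R i) - partial f i x| <= d) _.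
case.
  move=> x _.
  have /cvgrPdist_lt/(_ (d / 2)) := cf x; rewrite divr_gt0// => /(_ isT).
  move=> /nbhs_box[r r0 xr].
  have r20 : 0 < r / 2 by rewrite divr_gt0.
  have e0 : 0 < r / 2 / (2 * L) by rewrite divr_gt0// mulr_gt0.
  (* Both radii are halved, so that [y] and its translate by at most one mesh width lie within [r]
     of [x]. *)
  exists ([set y : V | forall j, `|y 0 j - x 0 j| < r / 2], [set N | N.+1%:R^-1 < r / 2 / (2 * L)]).
    split => /=; first exact: box_nbhs.
    exact: (near_infty_natSinv_lt (PosNum e0)).
  move=> [y N]/= [yx NL] t tL.
  have tr : `|t| < r / 2.
    by apply: le_lt_trans tL _; rewrite mulrC -ltr_pdivlMr// mulr_gt0.
  rewrite -[X in X - _](subrK (partial f i x)) -addrA.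
  apply: le_trans (ler_normD _ _) _; rewrite [d]splitr; apply: lerD.
    rewrite distrC; apply/ltW/xr => j.
    rewrite -[X in X - _](subrK (y 0 j)) -addrA.
    by rewrite [r]splitr (le_lt_trans (ler_normD _ _))// ltrD// (le_lt_trans _ tr)// coord_line_near.
  by apply/ltW/xr => j; rewrite (lt_trans (yx j))// ltr_pdivrMr// ltr_pMr// ltr1n.
move=> N0 _ HN; exists N0 => // N /HN {}HN.
set h := 2 * L / N.+1%:R.
have h0 : 0 < h by rewrite divr_gt0// mulr_gt0.
have Hk (k : {ffun 'I_n -> 'I_N.+1}) :
    `|h * partial f i (gridpt L k) - (f (gridpt L k + h *: ebasis R i) - f (gridpt L k))| <= h * d.
  have [|t th ->] := @partial_MVT _ _ f i (gridpt L k) h; first by move=> *; exact: df.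
  rewrite -mulrBr normrM (ger0_norm (ltW h0)) distrC.
  apply: ler_wpM2l; first exact: ltW.
  apply: (HN (gridpt L k)); last by rewrite -/h -(ger0_norm (ltW h0)).
  by move=> j /=; rewrite in_itv/= -ler_norml gridpt_bound// ltW.
rewrite -(ler_pM2l h0) -[X in X * `|_|](ger0_norm (ltW h0)) -normrM.
have -> : h * \sum_(k : {ffun 'I_n -> 'I_N.+1}) partial f i (gridpt L k) =
   \sum_(k : {ffun 'I_n -> 'I_N.+1}) (h * partial f i (gridpt L k) - (f (gridpt L k + h *: ebasis R i) - f (gridpt L k))).
  rewrite sumrB sumrB sum_grid_shift ?subrr ?subr0 ?mulr_sumr//; last exact: ltW.
  by move=> x xL; apply: f0; rewrite xL.
apply: le_trans (ler_norm_sum _ _ _) _.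
apply: le_trans (ler_sum _ (fun k _ => Hk k)) _.
by rewrite sumr_const card_ffun !card_ord -[X in X <= _]mulr_natr natrX mulrA.
Qed.

End grid.

(** * Counting grid points *)

Lemma modn_inj_close (T a b : nat) :
  (a <= b + T)%N -> (b <= a + T)%N -> a = b %[mod T.+1] -> a = b.
Proof.
wlog ab : a b / (a <= b)%N.
  by move=> H ha hb E; case: (leqP a b) => [/H|/ltnW/H HH]; [exact|apply/esym/HH].
move=> _ bT /esym/eqP; rewrite eqn_mod_dvd// => /dvdnP[[|c] E]; first by lia.
by move: E bT; rewrite mulSn => E bT; lia.
Qed.

Lemma card_family_prod {I J : finType} (F : I -> pred J) :
  #|family F| = (\prod_i #|F i|)%N.
Proof. by rewrite card_family foldrE big_map big_enum. Qed.

(* Reducing the coordinates [i] and [j] modulo [T.+1] is injective on [A]. *)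
Lemma slice_card {n N T : nat} (A : {set {ffun 'I_n -> 'I_N.+1}}) (i j : 'I_n) :
  i != j ->
  (forall k k', k \in A -> k' \in A -> (forall l, l != i -> l != j -> k l = k' l) ->
    (k i <= k' i + T)%N /\ (k j <= k' j + T)%N) ->
  (#|A| * N.+1 ^ 2 <= T.+1 ^ 2 * N.+1 ^ n)%N.
Proof.
move=> ij HA.
(* [family F] contains the reduced tuples: two coordinates up to [T], the others free. The factor
   [N.+1 ^ 2] in the statement avoids the exponent [n - 2]. *)
pose F (l : 'I_n) : pred 'I_N.+1 := if (l == i) || (l == j) then [pred a : 'I_N.+1 | (a < T.+1)%N] else predT.
pose phi (k : {ffun 'I_n -> 'I_N.+1}) : {ffun 'I_n -> 'I_N.+1} :=
  [ffun l => if (l == i) || (l == j) then inord (k l %% T.+1) else k l].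
have modE (a : 'I_N.+1) : (a %% T.+1 < N.+1)%N by rewrite (leq_ltn_trans (leq_mod _ _)).
have phi_inj : {in A &, injective phi}.
  move=> k k' kA k'A /ffunP E.
  have E1 l : l != i -> l != j -> k l = k' l.
    by move=> /negbTE li /negbTE lj; have := E l; rewrite !ffunE li lj.
  have E2 l : (l == i) || (l == j) -> k l = k' l %[mod T.+1].
    by move=> lij; have := E l; rewrite !ffunE lij => /(congr1 val); rewrite /= !inordK.
  have [ki kj] := HA _ _ kA k'A E1.
  have [|ki' kj'] := HA _ _ k'A kA; first by move=> l li lj; rewrite E1.
  apply/ffunP => l; have [->|li] := eqVneq l i.
    by apply/val_inj/(modn_inj_close ki ki')/E2; rewrite eqxx.
  have [->|lj] := eqVneq l j; last exact: E1.
  by apply/val_inj/(modn_inj_close kj kj')/E2; rewrite eqxx orbT.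
have cA : (#|A| <= \prod_l #|F l|)%N.
  rewrite -(card_in_imset phi_inj) -card_family_prod; apply: subset_leq_card; apply/fintype.subsetP => _ /imsetP[k _ ->].
  apply/familyP => l; rewrite /F ffunE; case: ifP => // _.
  by rewrite inE /= inordK// ltn_pmod.
(* Only an inequality, since [T] may exceed [N]. *)
have cF l : (l == i) || (l == j) -> (#|F l| <= T.+1)%N.
  move=> lij; rewrite /F lij -[leqRHS]card_ord.
  have gi : {in [pred a : 'I_N.+1 | (a < T.+1)%N] &, injective (fun a : 'I_N.+1 => inord a : 'I_T.+1)}.
    by move=> a b; rewrite !inE => aT bT /(congr1 val); rewrite /= !inordK// => /val_inj.
  by rewrite -(card_in_image gi) max_card.
apply: leq_trans (leq_mul cA (leqnn _)) _.
have {1}-> : (N.+1 ^ n = \prod_(l < n) N.+1)%N by rewrite prod_nat_const card_ord.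
rewrite (bigD1 i)//= [in leqRHS](bigD1 i)//= (bigD1 j) 1?eq_sym//= [in leqRHS](bigD1 j) 1?eq_sym//=.
rewrite [X in (_ * (_ * X) * _)%N](_ : _ = \prod_(l < n | (l != i) && (l != j)) N.+1)%N; last first.
  by apply: eq_bigr => l /andP[/negbTE li /negbTE lj]; rewrite /F li lj card_ord.
set P := (\prod_(_ < n | _) _)%N.
have Hi : (#|F i| <= T.+1)%N by apply: cF; rewrite eqxx.
have Hj : (#|F j| <= T.+1)%N by apply: cF; rewrite eqxx orbT.
have -> : (#|F i| * (#|F j| * P) * N.+1 ^ 2 = #|F i| * #|F j| * (P * N.+1 ^ 2))%N by lia.
have -> : (T.+1 ^ 2 * (N.+1 * (N.+1 * P)) = T.+1 * T.+1 * (P * N.+1 ^ 2))%N by lia.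
by rewrite leq_mul// leq_mul.
Qed.

Section count.
Context {R : realType}.
Implicit Types (L : R).

(** Counting to the right of [q] alone would give the proportion [r / (2 * L)] up to rounding; the
    mesh is at most [r / 2], so rounding costs at most half of it. *)
Lemma axis_count (q r L : R) (N : nat) : 0 < r -> `|q| + r < L ->
  2 * L / N.+1%:R <= r / 2 ->
  r / (4 * L) * N.+1%:R <=
   #|[pred a : 'I_N.+1 | `|- L + 2 * L / N.+1%:R * a%:R - q| <= r]|%:R.
Proof.
move=> r0 qL; have L0 : 0 < L by apply: le_lt_trans qL; rewrite addr_ge0// ltW.
have N0 : 0 < N.+1%:R :> R by [].
have hE : 2 * L = 2 * L / N.+1%:R * N.+1%:R by rewrite divfK.
set h := 2 * L / N.+1%:R in hE *; move=> hr.
have h0 : 0 < h by rewrite divr_gt0// mulr_gt0.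
have qL0 : 0 <= q + L by have := lerNnormlW (lexx `|q|); lra.
have qL2 : q + r < L by have := ler_norm q; lra.
(* [k0] is the last index whose point does not exceed [q]; the next [T] indices give points in
   [(q, q + r]]. *)
pose k0 := Num.truncn ((q + L) / h).
have /andP[k0l k0u] : (k0%:R <= (q + L) / h < k0.+1%:R).
  by apply: truncn_itv; rewrite divr_ge0// ltW.
pose T := Num.truncn (r / h).
have /andP[Tl Tu] : (T%:R <= r / h < T.+1%:R).
  by apply: truncn_itv; rewrite divr_ge0// ltW.
rewrite ler_pdivlMr// in k0l; rewrite ltr_pdivrMr// in k0u.
rewrite ler_pdivlMr// in Tl; rewrite ltr_pdivrMr// in Tu.
have aN (t : 'I_T) : (k0 + t.+1 < N.+1)%N.
  rewrite -(ltr_nat R) -(ltr_pM2r h0) natrD mulrDl [ltRHS]mulrC -hE.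
  have : (t.+1%:R <= T%:R :> R) by rewrite ler_nat.
  by move=> /(fun H => ler_wpM2r (ltW h0) H); lra.
pose g (t : 'I_T) : 'I_N.+1 := inord (k0 + t.+1).
have gi : injective g.
  move=> a b /(congr1 val); rewrite /= !inordK// => /eqP.
  by rewrite eqn_add2l eqSS => /eqP/val_inj.
have TF : (T <= #|[pred a : 'I_N.+1 | (- r <= - L + h * a%:R - q <= r)%R]|)%N.
  rewrite -[leqLHS]card_ord -(card_codom gi); apply: subset_leq_card; apply/fintype.subsetP => _ /codomP[t ->].
  rewrite inE/= inordK//.
  have : (t.+1%:R <= T%:R :> R) by rewrite ler_nat.
  move=> /(fun H => ler_wpM2r (ltW h0) H).
  have : (1 <= t.+1%:R :> R) by rewrite ler1n.
  move=> /(fun H => ler_wpM2r (ltW h0) H).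
  rewrite natrD mulrDr; move: k0u; rewrite -natr1 mulrDl.
  by rewrite ![h * _]mulrC => ? ? ?; apply/andP; split; lra.
rewrite (eq_card (B := [pred a : 'I_N.+1 | (- r <= - L + h * a%:R - q <= r)%R])); last first.
  by move=> a; rewrite !inE/= ler_norml.
apply: (@le_trans _ _ T%:R); last by rewrite ler_nat.
rewrite -(ler_pM2r h0) -[X in X <= _]mulrA [N.+1%:R * _]mulrC -hE.
have -> : r / (4 * L) * (2 * L) = r / 2 by field; rewrite gt_eqF.
by move: Tu; rewrite -natr1 mulrDl; lra.
Qed.

Context {n : nat}.

(** A box carries a fraction of the grid bounded below uniformly in [N]: the gain that the error
    terms must not outweigh. *)
Lemma box_count (q : 'rV[R]_n) (r L : R) : 0 < r -> 0 < L ->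
  (forall i, `|q 0 i| + r < L) ->
  exists2 c : R, 0 < c & \forall N \near \oo, c * N.+1%:R ^+ n <=
    #|[pred k : {ffun 'I_n -> 'I_N.+1} | [forall i, `|gridpt L k 0 i - q 0 i| <= r]]|%:R.
Proof.
move=> r0 L0 qL; exists ((r / (4 * L)) ^+ n).
  by rewrite exprn_gt0// divr_gt0// mulr_gt0.
have e0 : 0 < r / 2 / (2 * L) by rewrite divr_gt0// ?mulr_gt0// divr_gt0.
have := near_infty_natSinv_lt (PosNum e0); apply: filterS => N /= Nh.
have {}Nh : 2 * L / N.+1%:R <= r / 2.
  by rewrite mulrC -ler_pdivlMr ?mulr_gt0// ltW.
pose F i := [pred a : 'I_N.+1 | `|- L + 2 * L / N.+1%:R * a%:R - q 0 i| <= r].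
rewrite (eq_card (B := family F)); last first.
  move=> k; rewrite !inE; apply/forallP/familyP => H i; have := H i; by rewrite !inE/= !mxE.
rewrite card_family_prod natr_prod -exprMn.
rewrite -[in leLHS](card_ord n) -prodr_const; apply: ler_prod => i _.
by rewrite axis_count// mulr_ge0// divr_ge0// ltW// mulr_gt0.
Qed.
End count.

(** * Grid points near the common zeros of functions whose Jacobian has rank at least two *)

Lemma coord_lt_sqnorm {R : realType} {m : nat} (a : 'I_m -> R) (c : 'I_m) (e : R) : 0 < e ->
  \sum_b a b ^+ 2 < 2 * e ^+ 2 -> `|a c| < 2 * e.
Proof.
move=> e0 H; rewrite -(ltr_pXn2r (n:=2)) ?nnegrE// ?mulr_ge0// ?ltW//.
rewrite -normrX ger0_norm ?sqr_ge0//; apply: lt_trans (_ : 2 * e ^+ 2 < _).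
  by apply: le_lt_trans H; rewrite (bigD1 c)//= lerDl sumr_ge0// => *; exact: sqr_ge0.
by rewrite exprMn ltr_pM2r ?exprn_gt0// expr2; lra.
Qed.

Section codim2.
Context {R : realType} {n : nat}.
Notation V := 'rV[R]_n.
Implicit Types (f g : V -> R) (p x : V) (i j : 'I_n) (N : nat) (L : R) (O K : set V).

(** A distance [d] amounts to at most [d / (2 * L) * N.+1] index steps; the [+ 1] pays for rounding
    when [slice_card] is applied. *)
Lemma grid_slice_card L N (A : {set {ffun 'I_n -> 'I_N.+1}}) i j (d : R) :
  0 < L -> 0 <= d -> i != j ->
  (forall k k', k \in A -> k' \in A -> (forall l, l != i -> l != j -> k l = k' l) ->
    `|gridpt L k 0 i - gridpt L k' 0 i| <= d /\ `|gridpt L k 0 j - gridpt L k' 0 j| <= d) ->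
  #|A|%:R * N.+1%:R ^+ 2 <= (d / (2 * L) * N.+1%:R + 1) ^+ 2 * N.+1%:R ^+ n.
Proof.
move=> L0 d0 ij HA; set e := d / (2 * L) * N.+1%:R.
have e0 : 0 <= e by rewrite mulr_ge0// divr_ge0// mulr_ge0// ltW.
have /andP[Tl Tu] := truncn_itv e0.
set T := Num.truncn e in Tl Tu.
have close (k k' : {ffun 'I_n -> 'I_N.+1}) l : `|gridpt L k 0 l - gridpt L k' 0 l| <= d -> (k l <= k' l + T)%N.
  have -> : gridpt L k 0 l - gridpt L k' 0 l = 2 * L / N.+1%:R * ((k l)%:R - (k' l)%:R).
    by rewrite !mxE; ring.
  have h0 : 0 < 2 * L / N.+1%:R by rewrite divr_gt0// mulr_gt0.
  rewrite normrM (ger0_norm (ltW h0)) => H.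
  have aux (q : R) : q != 0 -> d = 2 * L / q * (d / (2 * L) * q).
    by move=> q0; field; rewrite q0 gt_eqF.
  have : `|(k l)%:R - (k' l)%:R| <= e.
    rewrite -(ler_pM2l h0); apply: le_trans H _; rewrite /e le_eqVlt; apply/orP; left; apply/eqP.
    by apply: aux; rewrite pnatr_eq0.
  move=> /(le_trans (ler_norm _)) /le_lt_trans /(_ Tu).
  by rewrite ltrBlDr -natrD ltr_nat addSn ltnS addnC.
have : (#|A| * N.+1 ^ 2 <= T.+1 ^ 2 * N.+1 ^ n)%N.
  apply: (slice_card ij) => k k' kA k'A E.
  by have [/close ? /close ?] := HA _ _ kA k'A E.
rewrite -(ler_nat R) !natrM !natrX => /le_trans; apply.
apply: ler_wpM2r; first exact: exprn_ge0.
by rewrite -expr2 lerXn2r ?nnegrE ?addr_ge0// -natr1 lerD2r.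
Qed.

(** Cramer's rule with coefficients known up to [h]: the error [h * (|s| + |t|)] is absorbed on the
    left because [h * M] is at most half the determinant, which costs the factor 2. *)
Lemma small_system_bound (a b c d s t e h : R) : 0 <= e ->
  a * d - b * c != 0 ->
  let M := `|a| + `|b| + `|c| + `|d| in
  h * M <= `|a * d - b * c| / 2 ->
  `|a * s + b * t| <= e + h * (`|s| + `|t|) ->
  `|c * s + d * t| <= e + h * (`|s| + `|t|) ->
  `|s| + `|t| <= 2 * M / `|a * d - b * c| * e.
Proof.
move=> e0 D0 M hM H1 H2; set D := a * d - b * c in D0 hM *.
have D1 : 0 < `|D| by rewrite normr_gt0.
have Es : D * s = d * (a * s + b * t) - b * (c * s + d * t) by rewrite /D; ring.
have Et : D * t = a * (c * s + d * t) - c * (a * s + b * t) by rewrite /D; ring.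
set X := a * s + b * t in H1 Es Et; set Y := c * s + d * t in H2 Es Et.
set E := e + h * (`|s| + `|t|) in H1 H2.
have ns : `|D| * `|s| <= `|d| * E + `|b| * E.
  rewrite -normrM Es; apply: le_trans (ler_normB _ _) _.
  by rewrite !normrM lerD// ler_wpM2l.
have nt : `|D| * `|t| <= `|a| * E + `|c| * E.
  rewrite -normrM Et; apply: le_trans (ler_normB _ _) _.
  by rewrite !normrM lerD// ler_wpM2l.
have {}ns : `|D| * (`|s| + `|t|) <= M * E.
  by rewrite mulrDr; apply: le_trans (lerD ns nt) _; rewrite le_eqVlt /M; apply/orP; left; apply/eqP; ring.
have : h * M * (`|s| + `|t|) <= `|D| / 2 * (`|s| + `|t|) by rewrite ler_wpM2r// addr_ge0.
move: ns; rewrite /E; set S := `|s| + `|t|; set Da := `|D| in D1 *.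
by rewrite [X in _ -> _ -> _ <= X]mulrAC ler_pdivlMr// => H3 H4; lra.
Qed.

(** A nonzero minor of the Jacobian: it names the two functions to use and the two axes spanning the
    slices. *)
Definition rank_ge2 {m : nat} (g : 'I_m -> V -> R) p := exists a b i j,
  partial (g a) i p * partial (g b) j p - partial (g a) j p * partial (g b) i p != 0.

Context {m : nat}.

(** With all coordinates but [i] and [j] frozen, [(g a, g b)] separates points linearly near [p]. So
    in each slice the points where [g] is [O(e)] are within [O(e)] of one another, and they fill a
    proportion [O(e ^ 2)]. *)
Lemma codim2_count_local L (g : 'I_m -> V -> R) O p : 0 < L -> open O ->
  (forall a, C1_on O (g a)) -> O p ->
  rank_ge2 g p ->
  exists2 U, nbhs p U & exists2 c : R, 0 <= c & forall e : R, 0 < e ->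
    \forall N \near \oo,
    #|[set k : {ffun 'I_n -> 'I_N.+1} | `[< U (gridpt L k) /\
      \sum_a g a (gridpt L k) ^+ 2 < 2 * e ^+ 2 >] ]%SET|%:R <= c * e ^+ 2 * N.+1%:R ^+ n.
Proof.
move=> L0 oO Cg Op [a [b [i [j D0]]]].
set A1 := partial (g a) i p in D0 *; set A2 := partial (g a) j p in D0 *.
set A3 := partial (g b) i p in D0 *; set A4 := partial (g b) j p in D0 *.
have ij : i != j by apply: contra_neq D0 => ij; rewrite /A1 /A2 /A3 /A4 ij subrr.
pose M := `|A1| + `|A2| + `|A3| + `|A4|.
have M0 : 0 <= M by rewrite !addr_ge0.
pose D := A1 * A4 - A2 * A3.
have D1 : 0 < `|D| by rewrite normr_gt0.
pose h := `|D| / (2 * (M + 1)).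
have h0 : 0 < h by rewrite divr_gt0// mulr_gt0// ltr_wpDl.
have hM : h * M <= `|D| / 2.
  have -> : `|D| / 2 = h * (M + 1) by rewrite /h; field; lra.
  by rewrite ler_wpM2l ?lerDl// ltW.
have [r r0 Hr] : exists2 r, 0 < r & forall x, (forall l, `|x 0 l - p 0 l| < r) ->
    O x /\ forall a i, `|partial (g a) i p - partial (g a) i x| < h.
  have HH : \forall x \near p, forall c l, `|partial (g c) l p - partial (g c) l x| < h.
    apply: (@filter_forall _ _ _ _ (nbhs_filter p)) => c.
    apply: (@filter_forall _ _ _ _ (nbhs_filter p)) => l.
    by have /cvgrPdist_lt := C1_dcont (i:=l) (Cg c) Op; apply.
  apply: (@nbhs_box _ _ p (fun x => O x /\ forall a i, `|partial (g a) i p - partial (g a) i x| < h)).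
  by apply: filterI HH; exact: open_nbhs_nbhs.
(* Points of the box of radius [r / 3] differ by less than [2 * r / 3] in each coordinate, so the
   path [x], [z], [y] below, parallel to the axes, stays in the box of radius [r]. *)
have r30 : 0 < r / 3 by rewrite divr_gt0.
exists [set x | forall l, `|x 0 l - p 0 l| < r / 3]; first exact: box_nbhs.
(* The constant of [small_system_bound], times 4 because each [g c] varies by at most [4 * e]
   between two counted points. *)
pose c0 := 2 * M / `|D| * 4.
have c00 : 0 <= c0 by rewrite mulr_ge0// divr_ge0// mulr_ge0.
exists ((c0 / (2 * L) + 1) ^+ 2); first by rewrite sqr_ge0.
move=> e e0; have := near_infty_natSinv_lt (PosNum e0); apply: filterS => N /= Ne.
set A := [set k | _]%SET.
have ga x c : \sum_a g a x ^+ 2 < 2 * e ^+ 2 -> `|g c x| < 2 * e.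
  exact: (@coord_lt_sqnorm _ _ (g ^~ x)).
have HA : #|A|%:R * N.+1%:R ^+ 2 <= (c0 * e / (2 * L) * N.+1%:R + 1) ^+ 2 * N.+1%:R ^+ n.
  have c0e : 0 <= c0 * e by rewrite mulr_ge0// ltW.
  apply: (grid_slice_card L0 c0e ij).
  move=> k k'; rewrite !inE => -[/= xp xe] [/= yp ye] E.
  set x := gridpt L k in xp xe *; set y := gridpt L k' in yp ye *.
  set s := y 0 i - x 0 i; set t := y 0 j - x 0 j.
  have sE : x 0 i + s = y 0 i by rewrite addrC subrK.
  have tE : x 0 j + t = y 0 j by rewrite addrC subrK.
  have bnd l : `|y 0 l - x 0 l| < r * 2 / 3.
    rewrite -[X in X - _](subrK (p 0 l)) -addrA.
    rewrite (le_lt_trans (ler_normD _ _))// [ltRHS](_ : _ = r / 3 + r / 3); last by field.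
    by rewrite ltrD// distrC.
  pose z := x + s *: ebasis R i.
  have zp l : `|z 0 l - p 0 l| < r / 3.
    rewrite coord_line; case: eqP => [->|_]; last by rewrite mulr0 addr0.
    by rewrite mulr1 sE.
  have yE : y = z + t *: ebasis R j.
    apply/rowP => l; rewrite !coord_line; have [->|li] := eqVneq l i.
      by rewrite (negbTE ij) mulr0 addr0 mulr1 sE.
    rewrite mulr0 addr0; have [->|lj] := eqVneq l j; first by rewrite mulr1 tE.
    by rewrite mulr0 addr0 !mxE E.
  have inr (w : V) l (tau : R) : (forall q, `|w 0 q - p 0 q| < r / 3) -> `|tau| < r * 2 / 3 ->
     forall q, `|(w + tau *: ebasis R l) 0 q - p 0 q| < r.
    move=> wp taur q; rewrite -[X in X - _](subrK (w 0 q)) -addrA.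
    rewrite (le_lt_trans (ler_normD _ _))// [r in ltRHS](_ : _ = r * 2 / 3 + r / 3); last by field.
    by rewrite ltrD// (le_lt_trans (coord_line_near _ _ _ _)).
  have mv c : exists al be, [/\ `|partial (g c) i p - al| < h, `|partial (g c) j p - be| < h &
      g c y - g c x = al * s + be * t].
    have der (w : V) l (u : R) : (forall q, `|w 0 q - p 0 q| < r / 3) -> `|u| < r * 2 / 3 ->
       derivable (g c) (w + u *: ebasis R l) (ebasis R l).
      by move=> wp ur; have [Oq _] := Hr _ (inr w l u wp ur); have := C1_derive l (Cg c) Oq; case.
    have [|u1 us E1] := @partial_MVT _ _ (g c) i x s.
      by move=> u us; apply: der => //; exact: le_lt_trans us (bnd i).
    have [|u2 ut E2] := @partial_MVT _ _ (g c) j z t.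
      by move=> u ut; apply: der => //; exact: le_lt_trans ut (bnd j).
    exists (partial (g c) i (x + u1 *: ebasis R i)), (partial (g c) j (z + u2 *: ebasis R j)); split.
    - by apply: (Hr _ _).2; apply: inr => //; exact: le_lt_trans us (bnd i).
    - by apply: (Hr _ _).2; apply: inr => //; exact: le_lt_trans ut (bnd j).
    - by rewrite mulrC [_ * t]mulrC -E1 -E2 -yE -/z; ring.
  have lin c : `|partial (g c) i p * s + partial (g c) j p * t| <= 4 * e + h * (`|s| + `|t|).
    have [al [be [Hal Hbe Ec]]] := mv c.
    have -> : partial (g c) i p * s + partial (g c) j p * t =
       (g c y - g c x) + ((partial (g c) i p - al) * s + (partial (g c) j p - be) * t).
      by rewrite Ec; ring.
    apply: le_trans (ler_normD _ _) _; apply: lerD.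
      apply: le_trans (ler_normB _ _) _.
      by have := ga _ c xe; have := ga _ c ye; lra.
    apply: le_trans (ler_normD _ _) _; rewrite !normrM [X in _ <= X]mulrDr.
    by apply: lerD; apply: ler_wpM2r => //; exact: ltW.
  have e40 : 0 <= 4 * e by rewrite mulr_ge0// ltW.
  have := small_system_bound e40 D0 hM (lin a) (lin b); rewrite -/M mulrA -/D -/c0 => H.
  by split; rewrite distrC; apply: le_trans H; rewrite -/s -/t ?lerDl ?lerDr.
have N0 : 0 < N.+1%:R :> R by [].
rewrite -(ler_pM2r (exprn_gt0 2 N0)); apply: le_trans HA _.
rewrite [X in _ <= X]mulrAC; apply: ler_wpM2r; first exact: exprn_ge0.
rewrite -!exprMn.
(* For large [N] the rounding term 1 is itself at most [e * N.+1]; this is why [N] depends on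
   [e]. *)
have eN : 1 <= e * N.+1%:R by rewrite -ler_pdivrMr// div1r ltW.
rewrite lerXn2r ?nnegrE//.
- by rewrite addr_ge0// mulr_ge0// divr_ge0// ?mulr_ge0// ltW.
- by rewrite !mulr_ge0// ?addr_ge0// ?divr_ge0// ?mulr_ge0// ltW.
have -> : (c0 / (2 * L) + 1) * e * N.+1%:R = c0 * e / (2 * L) * N.+1%:R + e * N.+1%:R.
  by set il := (2 * L)^-1; ring.
by rewrite lerD2l.
Qed.

(** The local constants add up under unions. [c] is independent of [e], and [2 * e ^+ 2] is the
    level at which the cutoff reaches 1. *)
Lemma codim2_count L (g : 'I_m -> V -> R) O K : 0 < L -> open O ->
  (forall a, C1_on O (g a)) -> compact K -> K `<=` O ->
  (forall p, O p -> rank_ge2 g p) ->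
  exists2 c : R, 0 <= c & forall e : R, 0 < e ->
    \forall N \near \oo,
    #|[set k : {ffun 'I_n -> 'I_N.+1} | `[< K (gridpt L k) /\
      \sum_a g a (gridpt L k) ^+ 2 < 2 * e ^+ 2 >] ]%SET|%:R <= c * e ^+ 2 * N.+1%:R ^+ n.
Proof.
move=> L0 oO Cg cK KO rk; move: K cK KO => K cK KO.
apply: (@compact_ind _ K (fun A => exists2 c : R, 0 <= c & forall e : R, 0 < e ->
    \forall N \near \oo,
    #|[set k : {ffun 'I_n -> 'I_N.+1} | `[< A (gridpt L k) /\
      \sum_a g a (gridpt L k) ^+ 2 < 2 * e ^+ 2 >] ]%SET|%:R <= c * e ^+ 2 * N.+1%:R ^+ n)) => //.
- move=> A B AB [c c0 H]; exists c => // e /H; apply: filterS => N; apply: le_trans.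
  rewrite ler_nat; apply: subset_leq_card; apply/fintype.subsetP => k; rewrite !inE.
  by move=> -[/AB ? ?]; split.
- exists 0 => // e e0; near=> N; rewrite !mul0r lern0 cards_eq0.
  by apply/eqP/finset.setP => k; rewrite !inE; apply/negbTE/negP => /asboolP[].
- move=> A B [c c0 HA] [d d0 HB]; exists (c + d); first exact: addr_ge0.
  move=> e e0; apply: filterS2 (HA _ e0) (HB _ e0) => N hA hB.
  rewrite [(c + d) * _]mulrDl [leRHS]mulrDl; apply: le_trans (lerD hA hB); rewrite -natrD ler_nat.
  apply: leq_trans (leq_card_setU _ _); apply: subset_leq_card; apply/fintype.subsetP => k; rewrite !inE.
  by move=> -[[?|?] ?]; apply/orP; [left|right]; apply/asboolP.
- by move=> p Kp; apply: (codim2_count_local L0 oO Cg (KO _ Kp)); exact/rk/KO.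
Unshelve. all: by end_near. Qed.
End codim2.

(** * Cutoff functions *)

Section possq.
Context {R : realType}.

Definition possq (t : R) : R := Num.max t 0 ^+ 2.

Lemma possq_ge0 t : 0 <= possq t. Proof. exact: sqr_ge0. Qed.

Lemma possq_le0 t : t <= 0 -> possq t = 0.
Proof. by move=> t0; rewrite /possq max_r// expr0n. Qed.

Lemma possq_le (s t : R) : s <= t -> possq s <= possq t.
Proof.
move=> st; have : Num.max s 0 <= Num.max t 0 by rewrite ge_max !le_max st lexx orbT.
have max0 (x : R) : 0 <= Num.max x 0 by rewrite le_max lexx orbT.
by move=> stm; rewrite /possq lerXn2r// nnegrE.
Qed.

(** A quadratic remainder reduces the differentiability of [possq], also at 0, to polynomial
    inequalities, one per sign pattern. *)
Lemma is_derive_quadratic (f : R -> R) (x d : R) :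
  (forall h, `|f (x + h) - f x - d * h| <= h ^+ 2) -> is_derive x 1 f d.
Proof.
move=> Hf; suff H : (fun h => h^-1 *: ((f \o shift x) (h *: 1) - f x)) @ 0^' --> d.
  by split; [apply/cvg_ex; exists d|exact: cvg_lim H].
apply/cvgrPdist_le => e e0; near=> h.
have h0 : h != 0 by near: h; exact: nbhs_dnbhs_neq.
have he : `|h| <= e by near: h; apply: dnbhs0_le.
apply: le_trans he; rewrite /= [h *: 1]mulr1 [h + x]addrC.
have -> : d - h^-1 *: (f (x + h) - f x) = - (h^-1 * (f (x + h) - f x - d * h)).
  by rewrite /GRing.scale/=; field.
rewrite normrN normrM normfV ler_pdivrMl ?normr_gt0//.
by apply: le_trans (Hf h) _; rewrite -normrM -expr2 ger0_norm// sqr_ge0.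
Unshelve. all: by end_near. Qed.

Lemma is_derive_possq (t : R) : is_derive t 1 possq (2 * Num.max t 0).
Proof.
apply: is_derive_quadratic => h; rewrite /possq.
have [th|th] := leP (t + h) 0; have [t0|t0] := leP t 0; rewrite ler_norml; apply/andP; split; nra.
Qed.

Lemma continuous_dpossq : continuous (fun t : R => 2 * Num.max t 0).
Proof.
move=> t; apply: (@continuousM R R (cst 2) (fun t => Num.max t 0)).
  exact: cst_continuous.
by apply: (@continuous_max R R id (cst 0)); [exact: cvg_id|exact: cst_continuous].
Qed.

End possq.

Section cutoff.
Context {R : realType} {n m : nat}.
Notation V := 'rV[R]_n.
Implicit Types (f g : V -> R) (p x : V) (i j : 'I_n) (O K : set V).

Lemma compact_bound {T : topologicalType} (K : set T) (f : T -> R) : compact K ->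
  (forall x : T, K x -> {for x, continuous f}) ->
  exists2 B, 0 <= B & forall x : T, K x -> `|f x| <= B.
Proof.
move=> cK cf; apply: (@compact_ind _ K (fun A => exists2 B, 0 <= B & forall x : T, A x -> `|f x| <= B)) => //.
- by move=> A B AB [b b0 Hb]; exists b => // x /AB; exact: Hb.
- by exists 0.
- move=> A B [a a0 Ha] [b b0 Hb]; exists (a + b); first exact: addr_ge0.
  by move=> x [/Ha|/Hb] /le_trans; apply; rewrite ?lerDl ?lerDr.
- move=> x /cf /cvgrPdist_lt/(_ 1 ltr01) H.
  exists [set y | `|f x - f y| < 1] => //; exists (`|f x| + 1); first exact: addr_ge0.
  move=> y /= /ltW; rewrite distrC => xy; rewrite -[f y](subrK (f x)) addrC.
  by apply: le_trans (ler_normD _ _) _; rewrite lerD2l.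
Qed.

Lemma C1_possq O f : open O -> C1_on O f -> C1_on O (fun x => possq (f x)).
Proof.
move=> oO Cf; apply: (@C1_comp _ _ _ _ _ (fun t => 2 * Num.max t 0)) => // p Op.
- exact: is_derive_possq.
- exact: continuous_dpossq.
Qed.

Lemma partial_possq O f i p : C1_on O f -> O p ->
  partial (fun x => possq (f x)) i p = 2 * Num.max (f p) 0 * partial f i p.
Proof. by move=> Cf Op; exact (partial_comp i Cf Op (is_derive_possq (f p))). Qed.

Lemma C1_sqnorm O (g : 'I_m -> V -> R) : open O -> (forall a, C1_on O (g a)) ->
  C1_on O (fun x => \sum_a g a x ^+ 2).
Proof.
move=> oO Cg; apply: (C1_sum (index_enum 'I_m) oO) => a.
by apply: (C1_eq oO _ (C1_M oO (Cg a) (Cg a))) => x _; rewrite expr2.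
Qed.

Lemma partial_sqnorm O (g : 'I_m -> V -> R) i p : open O -> (forall a, C1_on O (g a)) -> O p ->
  partial (fun x => \sum_a g a x ^+ 2) i p = \sum_a 2 * g a p * partial (g a) i p.
Proof.
move=> oO Cg Op; rewrite (@partial_near _ _ _ (fun x => \sum_a g a x * g a x)); last first.
  by near=> x; apply: eq_bigr => a _; rewrite expr2.
rewrite (partial_sum _ _ oO (fun a => C1_M oO (Cg a) (Cg a)) Op).
by apply: eq_bigr => a _; rewrite (partialM _ (Cg a) (Cg a) Op); ring.
Unshelve. all: by end_near. Qed.

(** [eta] is a C1 step function of [|g|^2 / e^2]. Its derivatives live on the transition zone, and
    [C] does not depend on [e]. *)
Lemma cutoff O K (g : 'I_m -> V -> R) : open O -> compact K -> K `<=` O ->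
  (forall a, C1_on O (g a)) ->
  exists2 C : R, 0 <= C & forall e : R, 0 < e -> exists eta : V -> R,
   [/\ C1_on O eta, forall x, 0 <= eta x <= 1,
     forall x, \sum_a g a x ^+ 2 <= e ^+ 2 -> eta x = 0,
     forall x, 2 * e ^+ 2 <= \sum_a g a x ^+ 2 -> eta x = 1 &
     forall x i, K x -> `|partial eta i x| <= if \sum_a g a x ^+ 2 < 2 * e ^+ 2 then C / e else 0].
Proof.
move=> oO cK KO Cg.
have : forall ai : 'I_m * 'I_n, exists B, 0 <= B /\ forall x, K x -> `|partial (g ai.1) ai.2 x| <= B.
  move=> [a i]; have [|B B0 HB] := @compact_bound _ K (partial (g a) i) cK; last by exists B.
  by move=> x /KO; exact: C1_dcont (Cg a).
move=> /choice[B HB]; pose M := \sum_ai B ai.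
have M0 : 0 <= M by apply: sumr_ge0 => ai _; case: (HB ai).
have HM x a i : K x -> `|partial (g a) i x| <= M.
  move=> Kx; apply: le_trans ((HB (a, i)).2 x Kx) _; rewrite /M (bigD1 (a, i))//= lerDl.
  by apply: sumr_ge0 => ai _; case: (HB ai).
(* Each of the two [possq] layers contributes a factor 2, and [|g|^2 / e^2] has partial derivatives
   at most [m * (4 * e * M) / e^2] on the transition zone. *)
exists (16 * m%:R * M); first by rewrite !mulr_ge0.
move=> e e0; pose S x := \sum_a g a x ^+ 2.
have e20 : 0 < e ^+ 2 by rewrite exprn_gt0.
pose f x := (e ^+ 2)^-1 * S x + - 1.
have Cf0 : C1_on O (fun x => (e ^+ 2)^-1 * S x) by exact (C1_M oO (C1_cst _ oO) (C1_sqnorm oO Cg)).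
have Cf : C1_on O f := C1_D oO Cf0 (C1_cst (- 1) oO).
have Cf1 := C1_possq oO Cf.
have Cf2 : C1_on O (fun x => 1 - possq (f x)) := C1_B oO (C1_cst 1 oO) Cf1.
have Cf3 := C1_possq oO Cf2.
have Sge x : 2 * e ^+ 2 <= S x -> 1 <= possq (f x).
  move=> Sx; have : 1 <= f x.
    by rewrite /f lerBrDr -ler_pdivrMl ?invr_gt0// invrK mulrC.
  by move=> /possq_le; apply: le_trans; rewrite /possq max_l// expr1n.
(* [1 - possq (1 - possq (s - 1))] is a C1 step, 0 for [s <= 1] and 1 for [s >= 2]. *)
exists (fun x => 1 - possq (1 - possq (f x))); split.
- exact (C1_B oO (C1_cst 1 oO) Cf3).
- move=> x; rewrite subr_ge0 gerBl possq_ge0 andbT.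
  have : 1 - possq (f x) <= 1 by rewrite gerBl possq_ge0.
  by move=> /possq_le/le_trans; apply; rewrite /possq max_l// expr1n.
- move=> x Sx; rewrite (@possq_le0 _ (f x)).
    by rewrite subr0 /possq max_l// expr1n subrr.
  by rewrite /f subr_le0 ler_pdivrMl// mulr1.
- by move=> x /Sge Sx; rewrite possq_le0 ?subr0// subr_le0.
- move=> x i Kx; have Ox := KO _ Kx.
  rewrite (partialB _ (C1_cst 1 oO) Cf3 Ox) (partial_possq _ Cf2 Ox).
  rewrite (partialB _ (C1_cst 1 oO) Cf1 Ox) (partial_possq _ Cf Ox).
  rewrite (partialD _ Cf0 (C1_cst (-1) oO) Ox) (partialM _ (C1_cst _ oO) (C1_sqnorm oO Cg) Ox).
  have pc c : partial (fun=> c) i x = 0 :> R by exact: derive_cst.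
  rewrite !pc !sub0r addr0 mulr0 addr0 (partial_sqnorm _ oO Cg Ox).
  case: ifPn => [Sx|]; last first.
    rewrite -leNgt => /Sge Sx.
    by rewrite [Num.max (1 - _) 0]max_r ?subr_le0// !(mulr0, mul0r) oppr0 normr0.
  have fx : f x <= 1.
    by rewrite /f lerBlDr ler_pdivrMl// mulrC ltW.
  set a := 2 * Num.max (1 - _) 0; set b := 2 * Num.max (f x) 0; set s := \sum_a _.
  have a2 : 0 <= a <= 2.
    rewrite mulr_ge0 ?le_max ?lexx ?orbT//= ler_piMr// ge_max ler01 andbT.
    by rewrite gerBl possq_ge0.
  have b2 : 0 <= b <= 2.
    by rewrite mulr_ge0 ?le_max ?lexx ?orbT//= ler_piMr// ge_max ler01 andbT.
  have ss : `|s| <= m%:R * (4 * e * M).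
    apply: le_trans (ler_norm_sum _ _ _) _.
    rewrite mulr_natl -[in leRHS](card_ord m) -sumr_const; apply: ler_sum => c _.
    rewrite !normrM ger0_norm// ler_pM ?mulr_ge0 ?normr_ge0//; last exact: HM.
    by have := @coord_lt_sqnorm _ _ (g ^~ x) c e e0 Sx; lra.
  have /andP[a0 a2'] := a2; have /andP[b0 b2'] := b2.
  have e2i : 0 <= (e ^+ 2)^-1 by rewrite invr_ge0 ltW.
  rewrite !mulrN !normrN (normrM a) (normrM b) (normrM (e ^+ 2)^-1) (ger0_norm a0) (ger0_norm b0) (ger0_norm e2i).
  have -> : 16 * m%:R * M / e = 2 * (2 * ((e ^+ 2)^-1 * (m%:R * (4 * e * M)))) by field; lra.
  have H1 : (e ^+ 2)^-1 * `|s| <= (e ^+ 2)^-1 * (m%:R * (4 * e * M)).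
    by rewrite ler_wpM2l.
  have H0 : 0 <= (e ^+ 2)^-1 * `|s| by rewrite mulr_ge0.
  apply: ler_pM => //; first exact: mulr_ge0.
  exact: ler_pM.
Unshelve. all: by end_near. Qed.
End cutoff.

(** * Unit normals *)

Section normals.
Context {R : realType} {n : nat}.
Notation V := 'rV[R]_n.
Implicit Types (f : V -> R) (g : 'I_n -> V -> R) (p x : V) (i j : 'I_n) (O K : set V).

Definition sqnorm g p : R := \sum_j g j p ^+ 2.
Definition normal g i p : R := (Num.sqrt (sqnorm g p))^-1 * g i p.

Lemma sqnorm_ge0 g p : 0 <= sqnorm g p.
Proof. by apply: sumr_ge0 => j _; exact: sqr_ge0. Qed.

Lemma open_sublevel O f (c : R) : open O -> (forall p, O p -> {for p, continuous f}) ->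
  open [set p | O p /\ f p < c].
Proof.
move=> oO cf; rewrite openE => p [Op fp]; apply: filterI; first exact: open_nbhs_nbhs.
exact: (cf p Op) _ (lt_nbhsl fp).
Qed.

Lemma open_superlevel O f (c : R) : open O -> (forall p, O p -> {for p, continuous f}) ->
  open [set p | O p /\ c < f p].
Proof.
move=> oO cf; rewrite openE => p [Op fp]; apply: filterI; first exact: open_nbhs_nbhs.
exact: (cf p Op) _ (lt_nbhsr fp).
Qed.

Lemma C1_V O f : open O -> (forall p, O p -> f p != 0) -> C1_on O f ->
  C1_on O (fun x => (f x)^-1).
Proof.
move=> oO f0 Cf; apply: (@C1_on_intro _ _ _ _ (fun i x => - (f x) ^- 2 * partial f i x)) => //.
- by move=> p Op; apply: continuousV; [exact: f0|exact: C1_cont Cf Op].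
- move=> i p Op; have [df _] := C1_derive i Cf Op.
  by split; [apply: derivableV => //; exact: f0|rewrite deriveV//; exact: f0].
- move=> i p Op; apply: (@continuousM R V) => //; last exact: C1_dcont Cf Op.
  apply: (@continuousN R R^o V); apply: continuousV; first by rewrite expf_neq0// f0.
  have cf := C1_cont Cf Op; exact: (@continuousM R V f f).
Qed.

Lemma C1_normal O g i : open O -> (forall a, C1_on O (g a)) ->
  (forall p, O p -> 0 < sqnorm g p) -> C1_on O (normal g i).
Proof.
move=> oO Cg g0; apply: (C1_M oO _ (Cg i)); apply: C1_V => //.
  by move=> p /g0 Sp; rewrite gt_eqF// sqrtr_gt0.
apply: (C1_comp (h' := fun t => (2 * Num.sqrt t)^-1) oO (C1_sqnorm oO Cg)).
- by move=> p /g0; exact: is_derive1_sqrt.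
- move=> p /g0 Sp; apply: (@continuousV _ _ (fun t => 2 * Num.sqrt t)).
    by rewrite mulf_neq0// gt_eqF// sqrtr_gt0.
  apply: (@continuousM R R (cst 2)); first exact: cst_continuous.
  exact: sqrt_continuous.
Qed.

(** With [C] the dot product of [a] and [b], both sides equal [(A + B) * (1 - C / (A * B))]. So the
    left side is nonnegative and vanishes only when the unit vectors agree. *)
Lemma normal_dot_diff (a b : 'I_n -> R) :
  let A := Num.sqrt (\sum_j a j ^+ 2) in let B := Num.sqrt (\sum_j b j ^+ 2) in
  0 < A -> 0 < B ->
  \sum_i (A^-1 * a i - B^-1 * b i) * (a i - b i) =
  (A + B) / 2 * \sum_i (A^-1 * a i - B^-1 * b i) ^+ 2.
Proof.
move=> A B A0 B0.
have A2 : \sum_j a j ^+ 2 = A ^+ 2 by rewrite sqr_sqrtr// sumr_ge0// => *; exact: sqr_ge0.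
have B2 : \sum_j b j ^+ 2 = B ^+ 2 by rewrite sqr_sqrtr// sumr_ge0// => *; exact: sqr_ge0.
pose C := \sum_j a j * b j.
have -> : \sum_i (A^-1 * a i - B^-1 * b i) * (a i - b i) = A^-1 * A ^+ 2 + B^-1 * B ^+ 2 - (A^-1 + B^-1) * C.
  rewrite -A2 -B2 /C !mulr_sumr -sumrN -!big_split /=; apply: eq_bigr => i _; ring.
have -> : \sum_i (A^-1 * a i - B^-1 * b i) ^+ 2 = A^-1 ^+ 2 * A ^+ 2 + B^-1 ^+ 2 * B ^+ 2 - 2 * A^-1 * B^-1 * C.
  rewrite -A2 -B2 /C !mulr_sumr -sumrN -!big_split /=; apply: eq_bigr => i _; ring.
field; lra.
Qed.

Lemma normal_le1 g i p : 0 < sqnorm g p -> `|normal g i p| <= 1.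
Proof.
move=> S0; rewrite /normal; have s0 : 0 < Num.sqrt (sqnorm g p) by rewrite sqrtr_gt0.
rewrite normrM normfV (ger0_norm (sqrtr_ge0 _)) ler_pdivrMl// mulr1.
rewrite -(ler_pXn2r (n:=2)) ?nnegrE ?sqrtr_ge0// sqr_sqrtr ?sqnorm_ge0//.
rewrite -normrX ger0_norm ?sqr_ge0// /sqnorm (bigD1 i)//= lerDl sumr_ge0// => *; exact: sqr_ge0.
Qed.

Lemma normal_dot_ge0 g g' p : 0 < sqnorm g p -> 0 < sqnorm g' p ->
  0 <= \sum_i (normal g i p - normal g' i p) * (g i p - g' i p).
Proof.
move=> S0 S0'; rewrite (normal_dot_diff (a := fun i => g i p) (b := fun i => g' i p)) ?sqrtr_gt0//.
rewrite mulr_ge0 ?divr_ge0 ?addr_ge0 ?sqrtr_ge0//.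
by apply: sumr_ge0 => *; exact: sqr_ge0.
Qed.

Lemma normal_dot_eq0 g g' p : 0 < sqnorm g p -> 0 < sqnorm g' p ->
  \sum_i (normal g i p - normal g' i p) * (g i p - g' i p) <= 0 ->
  forall i, normal g i p = normal g' i p.
Proof.
move=> S0 S0'; rewrite (normal_dot_diff (a := fun i => g i p) (b := fun i => g' i p)) ?sqrtr_gt0//.
have AB : 0 < (Num.sqrt (\sum_j g j p ^+ 2) + Num.sqrt (\sum_j g' j p ^+ 2)) / 2.
  by rewrite divr_gt0// addr_gt0// sqrtr_gt0.
rewrite pmulr_rle0// => H i; apply/eqP; rewrite -subr_eq0 -sqrf_eq0.
have /eqP : \sum_i (normal g i p - normal g' i p) ^+ 2 = 0.
  by apply/eqP; rewrite eq_le H/= sumr_ge0// => *; exact: sqr_ge0.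
by rewrite psumr_eq0 => [|k _]; [move=> /allP/(_ i (mem_index_enum i))|exact: sqr_ge0].
Qed.

End normals.

(** * The test field *)

Section test_field.
Context {R : realType} {n : nat}.
Notation V := 'rV[R]_n.
Implicit Types (p x : V) (i j : 'I_n).
Context (O : set V) (w : V -> R) (gu gv : 'I_n -> V -> R).
Hypotheses (oO : open O) (Cw : C1_on O w).
Hypotheses (Cgu : forall i, C1_on O (gu i)) (Cgv : forall i, C1_on O (gv i)).

(** Extension by zero gives a field on the whole box, as the grid sums require; it is smooth across
    the boundary of [O] because the field already vanishes off [{w >= tau}]. *)
Definition test_field (eu ev : V -> R) (tau : R) i p : R :=
  if `[< O p >] then
    eu p * ev p * possq (w p - tau) * (normal gu i p - normal gv i p)
  else 0.

Context (eu ev : V -> R) (tau e : R).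
Hypotheses (e0 : 0 < e) (Ceu : C1_on O eu) (Cev : C1_on O ev).
Hypothesis eu0 : forall p, sqnorm gu p <= e ^+ 2 -> eu p = 0.
Hypothesis ev0 : forall p, sqnorm gv p <= e ^+ 2 -> ev p = 0.

Let K := [set p | O p /\ tau <= w p].
Let X := test_field eu ev tau.

Lemma test_field0 i p : ~ K p \/ sqnorm gu p <= e ^+ 2 \/ sqnorm gv p <= e ^+ 2 -> X i p = 0.
Proof.
rewrite /X /test_field; case: asboolP => // Op [nK|[/eu0 ->|/ev0 ->]].
- rewrite (@possq_le0 _ (w p - tau)) ?mulr0 ?mul0r//.
  by rewrite subr_le0 leNgt; apply/negP => /ltW tw; apply: nK.
- by rewrite !mul0r.
- by rewrite mulr0 !mul0r.
Qed.

(** The nonsingular part of [O], where both normals are C1. *)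
Let O4 := [set p | [set p | O p /\ 0 < sqnorm gu p] p /\ 0 < sqnorm gv p].

Let oO4 : open O4.
Proof.
have cS g : (forall i, C1_on O (g i)) -> forall p, O p -> {for p, continuous (sqnorm g)}.
  by move=> Cg p Op; exact: (C1_cont (C1_sqnorm oO Cg) Op).
have oO1 := open_superlevel (c := 0) oO (cS _ Cgu).
by apply: (open_superlevel oO1) => p [Op _]; exact: cS.
Qed.

Let O4O : O4 `<=` O. Proof. by move=> p [[]]. Qed.

Let Cnu i : C1_on O4 (normal gu i).
Proof. by apply: C1_normal => // [a|p [[]]//]; exact: C1_sub (Cgu a). Qed.

Let Cnv i : C1_on O4 (normal gv i).
Proof. by apply: C1_normal => // [a|p []//]; exact: C1_sub (Cgv a). Qed.

Let theta p := eu p * ev p * possq (w p - tau).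

Let Cee : C1_on O (fun p => eu p * ev p) := C1_M oO Ceu Cev.
Let Cwt : C1_on O (fun p => w p - tau) := C1_B oO Cw (C1_cst tau oO).
Let Cpw : C1_on O (fun p => possq (w p - tau)) := C1_possq oO Cwt.
Let Ctheta : C1_on O4 theta := C1_sub O4O (C1_M oO Cee Cpw).

Let XE i p : O p -> X i p = theta p * (normal gu i p - normal gv i p).
Proof. by rewrite /X /test_field => /asboolP ->. Qed.

(** Four open sets cover the space: the complement of [K] and the two sets where [gu] or [gv] is
    shorter than [e], on which the field is zero, and [O4], on which it is a product of C1
    functions. *)
Lemma C1_test_field i : closed K -> C1_on setT (X i).
Proof.
move=> cK; have oS g : (forall i, C1_on O (g i)) -> open [set p | O p /\ sqnorm g p < e ^+ 2].
  by move=> Cg; apply: open_sublevel => // p Op; exact: (C1_cont (C1_sqnorm oO Cg) Op).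
have C0 U : open U -> (forall p, U p -> X i p = 0) -> C1_on U (X i).
  move=> oU HU; apply: (C1_eq oU _ (C1_cst 0 oU)) => p; rewrite inE => /HU ->//.
have C1 : C1_on (~` K) (X i).
  by apply: C0; [exact: closed_openC|move=> p ?; apply: test_field0; left].
have C2 : C1_on [set p | O p /\ sqnorm gu p < e ^+ 2] (X i).
  by apply: C0; [exact: oS|move=> p [_ /ltW ?]; apply: test_field0; right; left].
have C3 : C1_on [set p | O p /\ sqnorm gv p < e ^+ 2] (X i).
  by apply: C0; [exact: oS|move=> p [_ /ltW ?]; apply: test_field0; right; right].
have C4 : C1_on O4 (X i).
  apply: (C1_eq oO4 _ (C1_M oO4 Ctheta (C1_B oO4 (Cnu i) (Cnv i)))) => p.
  by rewrite inE => /O4O Op; rewrite XE.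
apply: C1_sub (C1_setU C1 (C1_setU C2 (C1_setU C3 C4))) => p _.
have e20 : 0 < e ^+ 2 by rewrite exprn_gt0.
have [Kp|] := pselect (K p); last by left.
right; have Op : O p by case: Kp.
have [Su|Su] := ltP (sqnorm gu p) (e ^+ 2); first by left.
have [Sv|Sv] := ltP (sqnorm gv p) (e ^+ 2); first by right; left.
by right; right; split; [split => //|]; exact: lt_le_trans Su || exact: lt_le_trans Sv.
Qed.

Lemma partial_test_field0 i j p : closed K -> ~ K p -> partial (X i) j p = 0.
Proof.
move=> cK nK; rewrite (@partial_near _ _ _ (fun=> 0)); first exact: derive_cst.
have oK : open (~` K) by exact: closed_openC.
have : nbhs p (~` K) by exact: open_nbhs_nbhs.
by apply: filterS => q nKq; apply: test_field0; left.
Qed.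

Hypothesis dw : forall i p, O p -> partial w i p = gu i p - gv i p.
Hypothesis Hdiv : forall p, O p -> 0 < sqnorm gu p -> 0 < sqnorm gv p ->
  \sum_i partial (normal gv i) i p <= \sum_i partial (normal gu i) i p.
Hypotheses (eu01 : forall p, 0 <= eu p <= 1) (ev01 : forall p, 0 <= ev p <= 1).

(** The product rule gives three terms: [theta] times the difference of divergences, which is
    nonnegative; the term in [grad w], which is kept; and the term in the cutoff gradients, bounded
    using that components of unit normals are at most 1. *)
Lemma div_test_field_ge p (M a b : R) : K p -> possq (w p - tau) <= M ->
  (forall i, `|partial eu i p| <= a) -> (forall i, `|partial ev i p| <= b) ->
  eu p * ev p * (2 * Num.max (w p - tau) 0) *
    (\sum_i (normal gu i p - normal gv i p) * (gu i p - gv i p)) -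
    2 * n%:R * M * (a + b) <= \sum_i partial (X i) i p.
Proof.
move=> Kp pM Ha Hb; have Op : O p by case: Kp.
have M0 : 0 <= M := le_trans (possq_ge0 _) pM.
(* The signs of [a] and [b] are known only through some index [i], so [n = 0] is treated apart. *)
have DM0 : 0 <= 2 * n%:R * M * (a + b).
  have [->|n0] := eqVneq (n%:R : R) 0; first by rewrite mulr0 !mul0r.
  have : (0 < n)%N by rewrite lt0n; apply: contra_neq n0 => ->.
  move=> /(Ordinal)=> i; rewrite !mulr_ge0// addr_ge0//.
    exact: le_trans (normr_ge0 _) (Ha i).
  exact: le_trans (normr_ge0 _) (Hb i).
(* Where [gu] or [gv] is shorter than [e], the normals may be singular but the field is locally
   zero, and the lower bound is nonpositive. *)
have triv : eu p * ev p = 0 -> (\forall q \near p, forall i, X i q = 0) ->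
  eu p * ev p * (2 * Num.max (w p - tau) 0) *
    (\sum_i (normal gu i p - normal gv i p) * (gu i p - gv i p)) -
    2 * n%:R * M * (a + b) <= \sum_i partial (X i) i p.
  move=> -> X0; rewrite !mul0r sub0r big1 ?oppr_le0// => i _.
  rewrite (@partial_near _ _ _ (fun=> 0)); first exact: derive_cst.
  by apply: filterS X0 => q; exact.
have small g : (forall i, C1_on O (g i)) -> sqnorm g p < e ^+ 2 ->
    \forall q \near p, sqnorm g q <= e ^+ 2.
  move=> Cg Sg; have := C1_cont (C1_sqnorm oO Cg) Op => cS.
  have : \forall q \near p, sqnorm g q < e ^+ 2 by exact: (cS _ (lt_nbhsl Sg)).
  by apply: filterS => q /ltW.
have [Su|Su] := ltP (sqnorm gu p) (e ^+ 2).
  apply: triv; first by rewrite eu0 ?mul0r// ltW.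
  by apply: filterS (small _ Cgu Su) => q Sq i; apply: test_field0; right; left.
have [Sv|Sv] := ltP (sqnorm gv p) (e ^+ 2).
  apply: triv; first by rewrite ev0 ?mulr0// ltW.
  by apply: filterS (small _ Cgv Sv) => q Sq i; apply: test_field0; right; right.
have e20 : 0 < e ^+ 2 by rewrite exprn_gt0.
have Su0 := lt_le_trans e20 Su; have Sv0 := lt_le_trans e20 Sv.
have O4p : O4 p by [].
have pX i : partial (X i) i p =
    theta p * (partial (normal gu i) i p - partial (normal gv i) i p) +
    eu p * ev p * (2 * Num.max (w p - tau) 0) * ((normal gu i p - normal gv i p) * (gu i p - gv i p)) +
    possq (w p - tau) * ((normal gu i p - normal gv i p) * (eu p * partial ev i p + ev p * partial eu i p)).
  rewrite (@partial_near _ _ _ (fun q => theta q * (normal gu i q - normal gv i q))); last first.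
    have : nbhs p O by exact: open_nbhs_nbhs.
    by apply: filterS => q; exact: XE.
  rewrite (partialM i Ctheta (C1_B oO4 (Cnu i) (Cnv i)) O4p).
  rewrite (partialB i (Cnu i) (Cnv i) O4p).
  rewrite [partial theta i p](partialM i Cee Cpw Op) (partialM i Ceu Cev Op).
  rewrite (partial_possq i Cwt Op) (partialB i Cw (C1_cst tau oO) Op) dw//.
  have -> : partial (fun=> tau) i p = 0 by exact: derive_cst.
  by rewrite /theta; ring.
rewrite (eq_bigr _ (fun i _ => pX i)).
rewrite !big_split /= -!mulr_sumr sumrB.
set s3 := \sum_i _; set s1 := \sum_i _; set s2 := \sum_i _; set s4 := \sum_i _.
have [/andP[eu1 eu2] /andP[ev1 ev2]] := (eu01 p, ev01 p).
have H1 : 0 <= theta p * (s1 - s2).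
  apply: mulr_ge0; last by rewrite subr_ge0; exact: Hdiv.
  by rewrite /theta; apply: mulr_ge0; [exact: mulr_ge0|exact: possq_ge0].
have H3 : `|s4| <= n%:R * (2 * (a + b)).
  apply: le_trans (ler_norm_sum _ _ _) _.
  rewrite mulr_natl -[in leRHS](card_ord n) -sumr_const; apply: ler_sum => c _.
  rewrite normrM; apply: ler_pM => //.
    apply: le_trans (ler_normB _ _) _; have := normal_le1 c Su0; have := normal_le1 c Sv0; lra.
  apply: le_trans (ler_normD _ _) _; rewrite [a + b]addrC (normrM (eu p)) (normrM (ev p)) (ger0_norm eu1) (ger0_norm ev1).
  by apply: lerD; rewrite -[leRHS]mul1r; apply: ler_pM.
have H4 : - (2 * n%:R * M * (a + b)) <= possq (w p - tau) * s4.
  have : `|possq (w p - tau) * s4| <= M * (n%:R * (2 * (a + b))).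
    by rewrite normrM (ger0_norm (possq_ge0 _)); apply: ler_pM => //; exact: possq_ge0.
  by move=> /lerNnormlW; lra.
by move: H1 H4; lra.
Qed.

End test_field.

(** * Equality of the normals where [w] is positive *)

Section comparison.
Context {R : realType} {n : nat}.
Notation V := 'rV[R]_n.

(** If the normals differed at [q], the divergence of the test field would be bounded below by a
    positive constant on a box around [q]. Summed over the grid this gains [c * N.+1 ^ n], while the
    cutoff error and the total sum are each at most a quarter of that. *)
Lemma normals_eq (O : set V) (w : V -> R) (gu gv : 'I_n -> V -> R) (L : R) :
  open O -> C1_on O w -> (forall i, C1_on O (gu i)) -> (forall i, C1_on O (gv i)) ->
  (forall i p, O p -> partial w i p = gu i p - gv i p) ->
  0 < L -> (forall p, O p -> forall i, `|p 0 i| < L) ->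
  (forall tau, 0 < tau -> compact [set p | O p /\ tau <= w p]) ->
  (forall p, O p -> rank_ge2 gu p) -> (forall p, O p -> rank_ge2 gv p) ->
  (forall p, O p -> 0 < sqnorm gu p -> 0 < sqnorm gv p ->
    \sum_i partial (normal gv i) i p <= \sum_i partial (normal gu i) i p) ->
  forall q, O q -> 0 < w q -> 0 < sqnorm gu q -> 0 < sqnorm gv q ->
  forall i, normal gu i q = normal gv i q.
Proof.
move=> oO Cw Cgu Cgv dw L0 OL cK rku rkv Hdiv q Oq wq Suq Svq.
apply: normal_dot_eq0 => //; rewrite leNgt; apply/negP => fq.
pose f p := \sum_i (normal gu i p - normal gv i p) * (gu i p - gv i p).
pose tau := w q / 2; have tau0 : 0 < tau by rewrite divr_gt0.
pose K := [set p | O p /\ tau <= w p].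
have {}cK : compact K by exact: cK.
have KO : K `<=` O by move=> p [].
have clK : closed K by apply: compact_closed => //; exact: norm_hausdorff.
have [M M0 HM] : exists2 M : R, 0 <= M & forall p : V, K p -> possq (w p - tau) <= M.
  have [|M M0 HM] := @compact_bound R V K (fun p => possq (w p - tau)) cK.
    move=> p /KO Op; exact: (C1_cont (C1_possq oO (C1_B oO Cw (C1_cst tau oO))) Op).
  by exists M => // p /HM; exact: le_trans (ler_norm _).
pose F (p : V) : R := 2 * Num.max (w p - tau) 0 * f p.
have Fq : 0 < F q.
  rewrite /F mulr_gt0// mulr_gt0// lt_max subr_gt0 /tau; apply/orP; left.
  by rewrite ltr_pdivrMr// ltr_pMr// ltr1n.
pose S := Num.min (sqnorm gu q) (sqnorm gv q).
have S0 : 0 < S by rewrite lt_min Suq.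
have [r r0 Hr] : exists2 r : R, 0 < r & forall x : V, (forall i, `|x 0 i - q 0 i| < r) ->
    [/\ O x, tau <= w x, F q / 2 <= F x, S / 2 <= sqnorm gu x & S / 2 <= sqnorm gv x].
  pose O1 := [set p | O p /\ 0 < sqnorm gu p]; pose O2 := [set p | O1 p /\ 0 < sqnorm gv p].
  have cS g : (forall i, C1_on O (g i)) -> forall p, O p -> {for p, continuous (sqnorm g)}.
    by move=> Cg p Op; exact: (C1_cont (C1_sqnorm oO Cg) Op).
  have oO1 : open O1 := open_superlevel oO (cS _ Cgu).
  have oO2 : open O2 by apply: (open_superlevel oO1) => p [Op _]; exact: cS.
  have O2O : O2 `<=` O by move=> p [[]].
  have CN g : (forall i, C1_on O (g i)) -> (forall p, O2 p -> 0 < sqnorm g p) ->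
      forall i, C1_on O2 (normal g i).
    by move=> Cg g0 i; apply: C1_normal => // a; exact: C1_sub (Cg a).
  have Cf : C1_on O2 f.
    apply: (C1_sum (index_enum 'I_n) oO2) => i.
    have C1 := C1_B oO2 (CN _ Cgu (fun p O2p => O2p.1.2) i) (CN _ Cgv (fun p O2p => O2p.2) i).
    exact (C1_M oO2 C1 (C1_B oO2 (C1_sub O2O (Cgu i)) (C1_sub O2O (Cgv i)))).
  have O2q : O2 q by [].
  have cF : {for q, continuous F}.
    have cw := C1_cont (C1_B oO Cw (C1_cst tau oO)) Oq.
    have cd : {for q, continuous (fun p => 2 * Num.max (w p - tau) 0)}.
      by apply: (@continuous_comp _ _ _ (fun p => w p - tau) (fun t : R => 2 * Num.max t 0)) => //; exact: continuous_dpossq.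
    exact: (@continuousM R V _ f q cd (C1_cont Cf O2q)).
  have n1 : \forall x \near q, O x by exact: open_nbhs_nbhs.
  have gt_near (h : V -> R) (c : R) : {for q, continuous h} -> c < h q -> \forall x \near q, c <= h x.
    move=> ch chq; have : \forall x \near q, c < h x by exact: (ch _ (lt_nbhsr chq)).
    by apply: filterS => x /ltW.
  have half (c : R) : 0 < c -> c / 2 < c by move=> c0; rewrite ltr_pdivrMr// ltr_pMr// ltr1n.
  have n2 := gt_near _ _ (C1_cont Cw Oq) (half _ wq).
  have n3 := gt_near _ _ cF (half _ Fq).
  have n4 : \forall x \near q, S / 2 <= sqnorm gu x.
    by apply: gt_near (cS _ Cgu _ Oq) _; rewrite (lt_le_trans (half _ S0))// ge_min lexx.
  have n5 : \forall x \near q, S / 2 <= sqnorm gv x.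
    by apply: gt_near (cS _ Cgv _ Oq) _; rewrite (lt_le_trans (half _ S0))// ge_min lexx orbT.
  apply: (@nbhs_box _ _ q (fun x => [/\ O x, tau <= w x, F q / 2 <= F x, S / 2 <= sqnorm gu x & S / 2 <= sqnorm gv x])).
  apply: filterS2 (filterI n1 n2) (filterI n3 (filterI n4 n5)) => x [? ?] [? [? ?]].
  by split.
(* The radius is shrunk so that the closed box fits both inside the neighbourhood above and inside
   the grid. *)
have [r1 [r10 r1r r1L]] : exists r1 : R, [/\ 0 < r1, r1 < r & forall i, `|q 0 i| + r1 < L].
  pose d := \big[Num.min/r]_i (L - `|q 0 i|).
  have d0 : 0 < d by apply/bigmin_gtP; split => // i _; rewrite subr_gt0 OL.
  have d2 : d / 2 < d by rewrite ltr_pdivrMr// ltr_pMr// ltr1n.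
  exists (d / 2); split; first by rewrite divr_gt0.
    by apply: lt_le_trans d2 _; exact: bigmin_le_id.
  move=> i; rewrite -ltrBrDl; apply: lt_le_trans d2 _; exact: bigmin_le_cond.
have [kap kap0 Hkap] := box_count r10 L0 r1L.
have [Cu Cu0 Hcu] := cutoff oO cK KO Cgu.
have [Cv Cv0 Hcv] := cutoff oO cK KO Cgv.
have [au au0 Hau] := codim2_count L0 oO Cgu cK KO rku.
have [av av0 Hav] := codim2_count L0 oO Cgv cK KO rkv.
pose c := F q / 2 * kap; have c0 : 0 < c by rewrite mulr_gt0// divr_gt0.
(* A gradient bound [Cu / e] on a proportion [au * e ^+ 2] of the grid leaves one factor [e]: the
   total cutoff error is [D * e]. *)
pose D := 2 * n%:R * M * (Cu * au + Cv * av).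
have D0 : 0 <= D by rewrite !mulr_ge0// addr_ge0// mulr_ge0.
(* The first bound makes both cutoffs 1 on the box around [q]; the second makes [D * e] at most
   [c / 4], with [D + 1] because [D] may be 0. *)
pose e := Num.min (Num.sqrt (S / 4)) (c / (4 * (D + 1))).
have D10 : 0 < D + 1 by rewrite ltr_wpDl.
have e0 : 0 < e.
  by rewrite lt_min sqrtr_gt0 !divr_gt0// mulr_gt0.
have eS : 2 * e ^+ 2 <= S / 2.
  have : e ^+ 2 <= S / 4.
    have S4 : 0 <= S / 4 by rewrite divr_ge0// ltW.
    rewrite -[leRHS](sqr_sqrtr S4) lerXn2r ?nnegrE ?sqrtr_ge0 ?(ltW e0)//.
    by rewrite ge_min lexx.
  by lra.
have eD : D * e <= c / 4.
  have : e <= c / (4 * (D + 1)) by rewrite ge_min lexx orbT.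
  rewrite ler_pdivlMr ?mulr_gt0//; have := mulr_ge0 D0 (ltW e0); lra.
have [eu [Ceu eu01 eu0 eu1 deu]] := Hcu e e0.
have [ev [Cev ev01 ev0 ev1 dev]] := Hcv e e0.
pose X := test_field O w gu gv eu ev tau.
have CX i : C1_on setT (X i) by exact: (C1_test_field oO Cw Cgu Cgv e0 Ceu Cev eu0 ev0).
pose d := c / (4 * n.+1%:R); have d0 : 0 < d by rewrite divr_gt0// mulr_gt0.
have HX i : \forall N \near \oo, `|\sum_(k : {ffun 'I_n -> 'I_N.+1}) partial (X i) i (gridpt L k)| <= d * N.+1%:R ^+ n.
  apply: sum_grid_partial => //.
  - by move=> x; have [_ /(_ i)[+ _]] := CX i; exact.
  - by move=> x; exact: (C1_dcont (CX i)).
  - move=> x xL; rewrite /X /test_field; case: asboolP => // Ox.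
    by have := OL _ Ox i; rewrite ltNge xL.
have {}HX : \forall N \near \oo, forall i, `|\sum_(k : {ffun 'I_n -> 'I_N.+1}) partial (X i) i (gridpt L k)| <= d * N.+1%:R ^+ n.
  exact: filter_forall.
have [N [[{}HX {}Hkap] [{}Hau {}Hav]]] := filter_ex (filterI (filterI HX Hkap) (filterI (Hau e e0) (Hav e e0))).
pose bad (g : 'I_n -> V -> R) (x : V) := K x /\ sqnorm g x < 2 * e ^+ 2.
(* The gain and the errors carry indicator functions, so that summing over the grid turns them into
   the cardinals estimated above. *)
have low (x : V) : F q / 2 * [forall i, `|x 0 i - q 0 i| <= r1]%:R -
    2 * n%:R * M * (Cu / e * `[< bad gu x >]%:R + Cv / e * `[< bad gv x >]%:R) <=
    \sum_i partial (X i) i x.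
  have [Kx|nKx] := pselect (K x); last first.
    rewrite [leRHS]big1; last first.
      by move=> i _; exact: (partial_test_field0 eu0 ev0).
    have -> : [forall i, `|x 0 i - q 0 i| <= r1] = false.
      apply/negbTE/negP => /forallP xq; apply: nKx.
      by have [] := Hr x; [move=> i; exact: le_lt_trans (xq i) r1r|split].
    by rewrite mulr0 sub0r oppr_le0 !mulr_ge0// addr_ge0// mulr_ge0// divr_ge0// ltW.
  have Ox := KO _ Kx.
  have Ha i : `|partial eu i x| <= Cu / e * `[< bad gu x >]%:R.
    apply: le_trans (deu x i Kx) _; rewrite -/(sqnorm gu x); case: ifPn => [Sx|_].
      by rewrite asboolT ?mulr1.
    by rewrite mulr_ge0// divr_ge0// ltW.
  have Hb i : `|partial ev i x| <= Cv / e * `[< bad gv x >]%:R.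
    apply: le_trans (dev x i Kx) _; rewrite -/(sqnorm gv x); case: ifPn => [Sx|_].
      by rewrite asboolT ?mulr1.
    by rewrite mulr_ge0// divr_ge0// ltW.
  have := div_test_field_ge oO Cw Cgu Cgv e0 Ceu Cev eu0 ev0 dw Hdiv eu01 ev01 Kx (HM _ Kx) Ha Hb.
  apply: le_trans; rewrite lerD2r.
  have maxw : 0 <= 2 * Num.max (w x - tau) 0 by rewrite mulr_ge0// le_max lexx orbT.
  case: forallP => [xq|_] /=; last first.
    rewrite mulr0; have [Sx|/eu0 ->] := ltP (e ^+ 2) (sqnorm gu x); last by rewrite !mul0r.
    have [Sx'|/ev0 ->] := ltP (e ^+ 2) (sqnorm gv x); last by rewrite mulr0 !mul0r.
    have e20 : 0 < e ^+ 2 by rewrite exprn_gt0.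
    have [/andP[? _] /andP[? _]] := (eu01 x, ev01 x).
    apply: mulr_ge0; first by apply: mulr_ge0 => //; exact: mulr_ge0.
    by apply: normal_dot_ge0; [exact: lt_trans Sx|exact: lt_trans Sx'].
  have [|_ _ Fx Sx Sx'] := Hr x; first by move=> i; exact: le_lt_trans (xq i) r1r.
  by rewrite eu1 ?ev1 ?(le_trans eS)// !mul1r mulr1.
have : \sum_(k : {ffun 'I_n -> 'I_N.+1}) \sum_i partial (X i) i (gridpt L k) <= n%:R * (d * N.+1%:R ^+ n).
  have -> z : n%:R * z = \sum_(i < n) z :> R by rewrite sumr_const card_ord mulr_natl.
  rewrite exchange_big /=; apply: ler_sum => i _.
  exact: le_trans (ler_norm _) (HX i).
apply/negP; rewrite -ltNge.
apply: lt_le_trans (ler_sum _ (fun k _ => low (gridpt L k))).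
rewrite sumrB -!mulr_sumr big_split /= -!mulr_sumr -!natr_sum.
have cnt (P : pred {ffun 'I_n -> 'I_N.+1}) : (\sum_k P k)%N = #|P|.
  by rewrite -sum1_card [RHS]big_mkcond; apply: eq_bigr => k _; case: ifP; rewrite unfold_in => ->.
have cnts (P : pred {ffun 'I_n -> 'I_N.+1}) : (\sum_k P k)%N = #|[set k | P k]%SET|.
  by rewrite cnt cardsE.
rewrite (cnt [pred k : {ffun 'I_n -> 'I_N.+1} | [forall i, `|gridpt L k 0 i - q 0 i| <= r1]]).
rewrite (cnts (fun k => `[< bad gu (gridpt L k) >])) (cnts (fun k => `[< bad gv (gridpt L k) >])).
set n1 := #|[pred k | _]|%:R in Hkap *; set n2 := #|_|%:R in Hau *; set n3 := #|_|%:R in Hav *.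
set Z := N.+1%:R ^+ n in Hkap Hau Hav *.
have Z0 : 0 < Z by rewrite exprn_gt0.
have L1 : c * Z <= F q / 2 * n1.
  have -> : c * Z = F q / 2 * (kap * Z) by rewrite mulrA.
  by rewrite ler_wpM2l// divr_ge0// ltW.
have L2 : Cu / e * n2 <= Cu * au * e * Z.
  have -> : Cu * au * e * Z = Cu / e * (au * e ^+ 2 * Z) by field; rewrite gt_eqF.
  by rewrite ler_wpM2l// divr_ge0// ltW.
have L3 : Cv / e * n3 <= Cv * av * e * Z.
  have -> : Cv * av * e * Z = Cv / e * (av * e ^+ 2 * Z) by field; rewrite gt_eqF.
  by rewrite ler_wpM2l// divr_ge0// ltW.
have L4 : 2 * n%:R * M * (Cu / e * n2 + Cv / e * n3) <= c / 4 * Z.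
  apply: (@le_trans _ _ (D * e * Z)); last by rewrite ler_wpM2r// ltW.
  have -> : D * e * Z = 2 * n%:R * M * (Cu * au * e * Z + Cv * av * e * Z) by rewrite /D; ring.
  by rewrite ler_wpM2l ?mulr_ge0// lerD.
have L5 : n%:R * (d * Z) <= c / 4 * Z.
  rewrite mulrA ler_wpM2r ?(ltW Z0)// /d.
  have -> : c / 4 = n.+1%:R * (c / (4 * n.+1%:R)) by rewrite invfM [RHS]mulrC -!mulrA mulVf ?mulr1// pnatr_eq0.
  by rewrite ler_wpM2r ?ler_nat// ltW.
have cZ : 0 < c * Z by rewrite mulr_gt0.
apply: le_lt_trans L5 _; apply: (@lt_le_trans _ _ (c * Z - c / 4 * Z)).
  by lra.
by rewrite lerD// lerN2.
Qed.

End comparison.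

(** * Curls *)

Section schwarz.
Context {R : realType} {n : nat}.
Notation V := 'rV[R]_n.
Implicit Types (f w : V -> R) (p x a : V) (i j : 'I_n) (O : set V).

Lemma partial_shift f a i x : derivable f (x + a) (ebasis R i) ->
  is_derive x (ebasis R i) (fun y => f (y + a)) (partial f i (x + a)).
Proof.
rewrite /partial /derivable /derive => df.
have E : (fun h : R => h^-1 *: (((fun y => f (y + a)) \o shift x) (h *: ebasis R i) - f (x + a))) =
    (fun h : R => h^-1 *: ((f \o shift (x + a)) (h *: ebasis R i) - f (x + a))).
  by apply/funext => h /=; rewrite addrA.
by split; [rewrite /derivable E|rewrite /derive E].
Qed.

(** The mean value theorem is used twice: along [i] for the increment of [w] in direction [j], then
    along [j] for [partial w i]. *)
Lemma second_difference O w p i j (s : R) : C2_on O w -> 0 <= s ->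
  (forall x : V, (forall l, `|x 0 l - p 0 l| <= 2 * s) -> O x) ->
  exists2 x : V, forall l, `|x 0 l - p 0 l| <= 2 * s &
    w (p + s *: ebasis R i + s *: ebasis R j) - w (p + s *: ebasis R i)
      - (w (p + s *: ebasis R j) - w p) = s * (s * partial (partial w i) j x).
Proof.
move=> [Cw Cdw] s0 Op; pose ej := s *: ebasis R j.
have in1 (a b : R) x : `|a| <= s -> `|b| <= s -> forall l,
    `|(p + a *: ebasis R i + b *: ebasis R j) 0 l - p 0 l| <= 2 * s.
  move=> a1 b1 l; rewrite -[X in X - _](subrK ((p + a *: ebasis R i) 0 l)) -addrA.
  apply: le_trans (ler_normD _ _) _.
  have := coord_line_near p i a l; have := coord_line_near (p + a *: ebasis R i) j b l; lra.
have O1 (a b : R) : `|a| <= s -> `|b| <= s -> O (p + a *: ebasis R i + b *: ebasis R j).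
  by move=> a1 b1; apply: Op; exact: in1.
have ns : `|s| = s by rewrite ger0_norm.
pose f x := w (x + ej) - w x.
have df (t : R) : `|t| <= `|s| -> is_derive (p + t *: ebasis R i) (ebasis R i) f
    (partial w i (p + t *: ebasis R i + ej) - partial w i (p + t *: ebasis R i)).
  rewrite ns => ts; apply: is_deriveB.
    apply: partial_shift; have Oq : O (p + t *: ebasis R i + ej) by apply: O1; rewrite ?ns.
    by have [] := C1_derive i Cw Oq.
  have Oq : O (p + t *: ebasis R i).
    by have := O1 t 0 ts; rewrite scale0r addr0; apply; rewrite normr0.
  exact (C1_derive i Cw Oq).
have [|t ts E] := @partial_MVT _ _ f i p s.
  by move=> t /df[].
have [|t' ts' E'] := @partial_MVT _ _ (partial w i) j (p + t *: ebasis R i) s.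
  move=> t' ts'; have Oq : O (p + t *: ebasis R i + t' *: ebasis R j).
    by rewrite ns in ts ts'; exact: O1.
  by have [] := C1_derive j (Cdw i) Oq.
exists (p + t *: ebasis R i + t' *: ebasis R j); first by rewrite ns in ts ts'; exact: in1.
rewrite -E' -[X in _ = s * X](is_derive_partial (df t ts)) -E /f; ring.
Qed.

(** The second difference is symmetric in [i] and [j], so the two mixed partials share a value at
    points arbitrarily close to [p]. *)
Lemma schwarz O w p i j : open O -> C2_on O w -> O p ->
  partial (partial w i) j p = partial (partial w j) i p.
Proof.
move=> oO Cw Op; apply/eqP; rewrite -subr_eq0 -normr_le0; apply/ler_addgt0Pr => e e0.
rewrite add0r; have e2 : 0 < e / 2 by rewrite divr_gt0.
have close (P Q A : R) : `|P - A| < e / 2 -> `|Q - A| < e / 2 -> `|P - Q| <= e.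
  move=> PA QA; have -> : P - Q = (P - A) - (Q - A) by ring.
  by apply: le_trans (ler_normB _ _) _; rewrite [e]splitr ltW// ltrD.
have near2 k l : \forall x \near p, `|partial (partial w k) l p - partial (partial w k) l x| < e / 2.
  by have /cvgrPdist_lt := C1_dcont (i:=l) (Cw.2 k) Op; apply.
have nO : \forall x \near p, O x by exact: open_nbhs_nbhs.
have [r r0 Hr] := nbhs_box (filterI nO (filterI (near2 i j) (near2 j i))).
pose s := r / 3.
have s0 : 0 < s by rewrite divr_gt0.
have s2r : 2 * s < r by rewrite /s; lra.
have Os (x : V) : (forall l, `|x 0 l - p 0 l| <= 2 * s) -> O x.
  by move=> xs; have [] := Hr x; [move=> l; exact: le_lt_trans (xs l) s2r|].
have [x xs Ex] := second_difference i j Cw (ltW s0) Os.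
have [y ys Ey] := second_difference j i Cw (ltW s0) Os.
have Exy : partial (partial w i) j x = partial (partial w j) i y.
  have sn0 : s != 0 by rewrite gt_eqF.
  apply: (mulfI sn0); apply: (mulfI sn0); apply: etrans (etrans (esym Ex) _) Ey.
  by rewrite [p + s *: ebasis R j + _]addrAC; ring.
have [_ [/= Hx _]] := Hr x (fun l => le_lt_trans (xs l) s2r).
have [_ [_ /= Hy]] := Hr y (fun l => le_lt_trans (ys l) s2r).
by rewrite Exy in Hx; exact (close _ _ _ Hx Hy).
Qed.

End schwarz.

Section curl.
Context {R : realType} {n : nat}.
Notation V := 'rV[R]_n.
Implicit Types (g W : 'I_n -> V -> R) (p : V) (i j k l : 'I_n) (O : set V).

Definition curl g i j p := partial (g i) j p - partial (g j) i p.

(* The Pluecker identity: a matrix of rank at most one has decomposable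
   antisymmetric part. *)
Lemma curl_rank_ge2 g p i j k l :
  curl g i j p != 0 -> curl g k l p != 0 ->
  curl g i k p = 0 -> curl g i l p = 0 -> curl g j k p = 0 -> curl g j l p = 0 ->
  rank_ge2 g p.
Proof.
rewrite /curl => ij kl ik il jk jl; apply: contrapT => nrk.
have minor a b c d : partial (g a) c p * partial (g b) d p = partial (g a) d p * partial (g b) c p.
  apply/eqP; rewrite -subr_eq0; apply/negPn/negP => H; apply: nrk.
  by exists a, b, c, d.
move: ij kl ik il jk jl (minor i k j l) (minor i l j k) (minor j k i l) (minor j l i k) (minor i j k l).
move: (partial (g i) j p) (partial (g j) i p) (partial (g k) l p) (partial (g l) k p)
  (partial (g i) k p) (partial (g k) i p) (partial (g i) l p) (partial (g l) i p)
  (partial (g j) k p) (partial (g k) j p) (partial (g j) l p) (partial (g l) j p).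
move=> a01 a10 a23 a32 a02 a20 a03 a30 a12 a21 a13 a31 h01 h23.
move=> /subr0_eq <- /subr0_eq <- /subr0_eq <- /subr0_eq <- E1 E2 E3 E4 E5.
(* By the first four minors and the vanishing curls, the expansion is twice the minor of rows [i],
   [j] and columns [k], [l]. *)
have : (a01 - a10) * (a23 - a32) == 0.
  apply/eqP.
  rewrite [LHS](_ : _ = a01 * a23 - a01 * a32 - a10 * a23 + a10 * a32); last by ring.
  by rewrite E1 E2 E3 E4; lra.
by rewrite mulf_eq0 (negbTE h01) (negbTE h23).
Qed.

(* [dG /\ W = 0] follows from [G /\ W = 0] when [W] is closed. *)
Lemma parallel_closed_eq0 O g W p i j k : open O ->
  (forall l, C1_on O (g l)) -> (forall l, C1_on O (W l)) -> O p ->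
  (forall q, O q -> forall a b, g a q * W b q = g b q * W a q) ->
  (forall a b, curl W a b p = 0) ->
  curl g i k p != 0 -> curl g k j p = 0 -> curl g j i p = 0 -> W j p = 0.
Proof.
move=> oO Cg CW Op par cW ik kj ji.
have D a b c : g a p * partial (W b) c p + W b p * partial (g a) c p =
    g b p * partial (W a) c p + W a p * partial (g b) c p.
  rewrite -(partialM c (Cg a) (CW b) Op) -(partialM c (Cg b) (CW a) Op).
  apply: partial_near; have : nbhs p O by exact: open_nbhs_nbhs.
  by apply: filterS => q Oq; exact: par.
(* In the cyclic sum the derivatives of [W] cancel, since [W] is closed. What remains is [curl g i k
   * W j + curl g k j * W i + curl g j i * W k = 0]. *)
have := D i j k; have := D j k i; have := D k i j.
have := cW i j; have := cW j k; have := cW k i; move: ik kj ji; rewrite /curl.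
move: (partial (g i) j p) (partial (g j) i p) (partial (g i) k p) (partial (g k) i p) (partial (g j) k p) (partial (g k) j p).
move: (partial (W i) j p) (partial (W j) i p) (partial (W i) k p) (partial (W k) i p) (partial (W j) k p) (partial (W k) j p).
move=> w1 w2 w3 w4 w5 w6 a1 a2 a3 a4 a5 a6 h /subr0_eq-> /subr0_eq-> /subr0_eq-> /subr0_eq-> /subr0_eq-> E1 E2 E3.
have : (a3 - a4) * W j p == 0 by apply/eqP; lra.
by rewrite mulf_eq0 (negbTE h) => /eqP.
Qed.

End curl.

(** * The field grad w + F *)

Section coord.
Context {R : realType} {n : nat}.
Notation V := 'rV[R]_n.
Implicit Types (p : V) (i j : 'I_n) (O : set V).

Lemma coord_is_derive i j p : is_derive p (ebasis R j) (fun q : V => q 0 i) ((i == j)%:R).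
Proof.
have H : (fun h : R => h^-1 *: (((fun q : V => q 0 i) \o shift p) (h *: ebasis R j) - p 0 i)) @ 0^' --> ((i == j)%:R : R).
  apply: cvg_near_cst; near=> h; have h0 : h != 0 by near: h; exact: nbhs_dnbhs_neq.
  by rewrite /= [h *: _ + p]addrC coord_line addrAC subrr add0r /GRing.scale/= mulKf.
by split; [apply/cvg_ex; exists ((i == j)%:R)|exact: cvg_lim H].
Unshelve. all: by end_near. Qed.

Lemma C1_coord O i : open O -> C1_on O (fun q : V => q 0 i).
Proof.
move=> oO; apply: (@C1_on_intro _ _ _ _ (fun j _ => (i == j)%:R)) => // *.
- exact: coord_continuous.
- exact: coord_is_derive.
- exact: cst_continuous.
Qed.

Lemma coord_le_norm p i : `|p 0 i| <= `|p|.
Proof.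
have -> : `|p| = mx_norm p by [].
by rewrite mx_normrE; apply/bigmax_geP; right => /=; exists (0, i).
Qed.

Lemma closed_superlevel {T : topologicalType} (A : set T) (f : T -> R) (c : R) : closed A ->
  {within A, continuous f} -> closed [set p | A p /\ c <= f p].
Proof.
move=> cA /continuous_closedP/(_ [set t | c <= t] (@closed_ge _ c)) /closed_subspaceP[U cU UA].
have -> : [set p | A p /\ c <= f p] = U `&` A.
  by rewrite UA; apply/seteqP; split => p /= [].
exact: closedI.
Qed.

End coord.

Section partner.
Context {m : nat}.
Implicit Types i j : 'I_(2 * m).

(** As [2 * m] is even, the successor of an even index is in range, so the default value in
    [partner] never occurs. *)
Lemma val_partner i : partner i = (if odd i then i.-1 else i.+1) :> nat.
Proof.
rewrite /partner insubT /=; last by [].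
have := ltn_ord i; case: (boolP (odd i)) => oi im; first by lia.
by have := odd_double_half i; rewrite (negbTE oi); lia.
Qed.

Lemma odd_partner i : odd (partner i) = ~~ odd i.
Proof. by rewrite val_partner; case: (boolP (odd i)) => oi; lia. Qed.

Lemma partnerK : involutive (@partner (2 * m)).
Proof.
move=> i; apply: val_inj; rewrite /= val_partner odd_partner val_partner.
by case: (boolP (odd i)) => oi /=; lia.
Qed.
End partner.

Section contact.
Context {R : realType} {m : nat}.
Notation V := 'rV[R]_(2 * m).
Implicit Types (O : set V) (w u v : V -> R) (p q : V) (i j : 'I_(2 * m)).

Definition cgrad w i p : R := (grad w p + Fvec p) 0 i.

Lemma cgradE w i p :
  cgrad w i p = partial w i p + (if odd i then 1 else -1) * p 0 (partner i).
Proof. by rewrite /cgrad !mxE; case: ifP => _; rewrite ?mul1r ?mulN1r. Qed.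

Lemma C1_cgrad O w i : open O -> C2_on O w -> C1_on O (cgrad w i).
Proof.
move=> oO Cw; have C1 := C1_M oO (C1_cst (if odd i then 1 else -1) oO) (C1_coord (partner i) oO).
by apply: (C1_eq oO _ (C1_D oO (Cw.2 i) C1)) => p _; rewrite cgradE.
Qed.

Lemma partial_cgrad O w i j p : open O -> C2_on O w -> O p ->
  partial (cgrad w i) j p =
  partial (partial w i) j p + (if odd i then 1 else -1) * (partner i == j)%:R.
Proof.
move=> oO Cw Op; have Cc := C1_coord (R := R) (partner i) oO.
have C1 := C1_M oO (C1_cst (if odd i then 1 else -1) oO) Cc.
have -> : cgrad w i = fun p => partial w i p + (if odd i then 1 else -1) * p 0 (partner i).
  by apply/funext => q; rewrite cgradE.
rewrite (partialD j (Cw.2 i) C1 Op) (partialM j (C1_cst _ oO) Cc Op).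
rewrite (is_derive_partial (coord_is_derive (partner i) j p)).
have -> : partial (fun=> if odd i then 1 else -1) j p = 0 :> R by exact: derive_cst.
by rewrite mulr0 addr0.
Qed.

(** The Hessian of [w] drops out by symmetry, leaving the curl of [F], the same for every [w]. *)
Lemma curl_cgrad O w i j p : open O -> C2_on O w -> O p ->
  curl (cgrad w) i j p = if partner i == j then (if odd i then 2 else -2) else 0.
Proof.
move=> oO Cw Op; rewrite /curl !(partial_cgrad _ _ oO Cw Op) (schwarz i j oO Cw Op).
have -> : (partner j == i) = (partner i == j) by rewrite -(inj_eq (inv_inj partnerK)) partnerK eq_sym.
case: eqP => [<-|_]; last by rewrite !mulr0 !addr0 subrr.
by rewrite odd_partner; case: (odd i) => /=; ring.
Qed.

Lemma cgrad_diff O u v i p : O p -> cgrad u i p - cgrad v i p = partial u i p - partial v i p.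
Proof. by move=> Op; rewrite !cgradE opprD addrACA subrr addr0. Qed.

(** This is where [m >= 2] enters: some conjugate pair misses the pair of [j]. *)
Lemma disjoint_pair j : (2 <= m)%N -> exists i,
  [/\ partner i != j, i != j & i != partner j].
Proof.
move=> m2; have H0 : (0 < 2 * m)%N by lia.
have H2 : (2 < 2 * m)%N by lia.
pose i0 := Ordinal H0; pose i2 := Ordinal H2.
have [j2|j2] := ltnP j 2.
  exists i2; rewrite -!val_eqE /= !val_partner /=; split; try lia.
  by case: ifP; lia.
exists i0; rewrite -!val_eqE /= !val_partner /=; split; try lia.
by case: ifP; lia.
Qed.

(** On two disjoint conjugate pairs the curl is [2] or [-2] within each pair and 0 across, so it is
    not decomposable. *)
Lemma cgrad_rank_ge2 O w p : (2 <= m)%N -> open O -> C2_on O w -> O p ->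
  rank_ge2 (cgrad w) p.
Proof.
move=> m2 oO Cw Op; have H0 : (0 < 2 * m)%N by lia.
pose j := Ordinal H0; have [i [ij1 ij2 ij3]] := disjoint_pair j m2.
have nz k : (if odd k then 2 else -2) != 0 :> R.
  by case: ifP => _; rewrite ?oppr_eq0 pnatr_eq0.
have pij : partner i != partner j by rewrite (inj_eq (inv_inj partnerK)).
have E := curl_cgrad _ _ oO Cw Op.
apply: (@curl_rank_ge2 _ _ (cgrad w) p i (partner i) j (partner j)); rewrite !E ?eqxx ?nz//.
- by rewrite (negbTE ij1).
- by rewrite (negbTE pij).
- by rewrite partnerK (negbTE ij2).
- by rewrite partnerK (negbTE ij3).
Qed.

Lemma normal_cgrad w i p : Nfield w p 0 i = normal (cgrad w) i p.
Proof. by rewrite /Nfield mxE. Qed.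

Lemma div_Nfield w p : div (Nfield w) p = \sum_i partial (normal (cgrad w) i) i p.
Proof.
apply: eq_bigr => i _; congr (partial _ i p).
by apply/funext => q; exact: normal_cgrad.
Qed.

Lemma sqnorm_gt0 (g : 'I_(2 * m) -> V -> R) p : (exists i, g i p != 0) -> 0 < sqnorm g p.
Proof.
move=> [i gi]; rewrite lt_neqAle sqnorm_ge0 andbT eq_sym /sqnorm psumr_eq0 => [|j _]; last exact: sqr_ge0.
by apply/allPn; exists i; rewrite ?mem_index_enum// sqrf_eq0.
Qed.

Lemma not_Sing w p : 0 < sqnorm (cgrad w) p -> ~ Sing w p.
Proof.
move=> S0 Sp; move: S0; rewrite /sqnorm big1 ?ltxx// => i _.
by rewrite /cgrad Sp mxE expr0n.
Qed.

End contact.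

(** * From the vanishing gradient to the comparison *)

(** Otherwise the superlevel set would have a point with largest [i]-th coordinate. Near it [w] is
    constant along that axis, so a further step would stay in the set. *)
Lemma locally_constant_compact_superlevel {R : realType} {n : nat} (O : set 'rV[R]_n)
  (w : 'rV[R]_n -> R) (i : 'I_n) (c : R) : open O -> C1_on O w ->
  compact [set p | O p /\ c <= w p] ->
  (forall p, O p -> c <= w p -> \forall q \near p, partial w i q = 0) ->
  forall p, O p -> ~ c <= w p.
Proof.
move=> oO Cw cK dw p Op wp.
have [|c' + cmax] := @compact_EVT_max _ _ (fun q : 'rV[R]_n => q 0 i) _ (ex_intro _ p (conj Op wp)) cK.
  by apply: continuous_subspaceT => q; exact: coord_continuous.
rewrite inE => -[Oc wc].
have nO : \forall q \near c', O q by exact: open_nbhs_nbhs.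
have [r r0 Hr] := nbhs_box (filterI nO (dw _ Oc wc)).
have r20 : 0 < r / 2 by rewrite divr_gt0.
have r2r : r / 2 < r by rewrite ltr_pdivrMr// ltr_pMr// ltr1n.
have inr (t : R) : `|t| <= `|r / 2| -> O (c' + t *: ebasis R i) /\ partial w i (c' + t *: ebasis R i) = 0.
  move=> tr; apply: Hr => j; apply: le_lt_trans (coord_line_near _ _ _ _) _.
  by apply: le_lt_trans tr _; rewrite ger0_norm// ltW.
have [|t tr E] := @partial_MVT _ _ w i c' (r / 2).
  by move=> t /inr[Ot _]; have [] := C1_derive i Cw Ot.
rewrite (inr t tr).2 mulr0 in E; have [Or _] := inr (r / 2) (lexx _).
have : c' + (r / 2) *: ebasis R i \in [set p | O p /\ c <= w p].
  by rewrite inE; split => //; rewrite (subr0_eq E).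
move=> /cmax; rewrite coord_line eqxx mulr1; apply/negP.
by rewrite -ltNge ltrDl.
Qed.

Theorem theoremC (R : realType) (m : nat) (Omega : set 'rV[R]_(2 * m))
  (u v : 'rV[R]_(2 * m) -> R) :
  (2 <= m)%N ->
  open Omega -> connected Omega -> bounded_set Omega ->
  C2_on Omega u -> C2_on Omega v ->
  {within closure Omega, continuous u} -> {within closure Omega, continuous v} ->
  (forall p, Omega p -> ~ (Sing u p \/ Sing v p) ->
     div (Nfield v) p <= div (Nfield u) p) ->
  (forall p, closure Omega p -> ~ Omega p -> u p <= v p) ->
  forall p, Omega p -> u p <= v p.
Proof.
move=> m2 oO _ bO Cu Cv cu cv Hdiv bd.
pose w p := u p - v p.
have Cw : C1_on Omega w := C1_B oO Cu.1 Cv.1.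
have dw i p : Omega p -> partial w i p = cgrad u i p - cgrad v i p.
  by move=> Op; rewrite (cgrad_diff _ _ _ Op) (partialB i Cu.1 Cv.1 Op).
have Cgu i := C1_cgrad i oO Cu; have Cgv i := C1_cgrad i oO Cv.
have /ex_strict_bound_gt0[L L0 HL] := bO.
have cK tau : 0 < tau -> compact [set p | Omega p /\ tau <= w p].
  move=> tau0; apply: bounded_closed_compact.
    by exists L; split; [exact: num_real|move=> x Lx p [/HL/ltW/le_trans + _]; apply; exact: ltW].
  (* Boundary points have [w <= 0 < tau], so passing to the closure adds nothing; the set on the
     right is closed. *)
  have -> : [set p | Omega p /\ tau <= w p] = [set p | closure Omega p /\ tau <= w p].
    apply/seteqP; split => p [Op wp]; split => //; first exact: subset_closure.
    apply: contrapT => /(bd _ Op); rewrite -subr_le0 => /(le_trans wp).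
    by rewrite leNgt tau0.
  apply: closed_superlevel; first exact: closed_closure.
  by move=> p; apply: (@continuousB _ R^o); [exact: cu|exact: cv].
have HL' p : Omega p -> forall i, `|p 0 i| < L.
  by move=> Op i; apply: le_lt_trans (HL _ Op); exact: coord_le_norm.
have rku p := @cgrad_rank_ge2 _ _ _ _ p m2 oO Cu.
have rkv p := @cgrad_rank_ge2 _ _ _ _ p m2 oO Cv.
have Hdiv' p : Omega p -> 0 < sqnorm (cgrad u) p -> 0 < sqnorm (cgrad v) p ->
    \sum_i partial (normal (cgrad v) i) i p <= \sum_i partial (normal (cgrad u) i) i p.
  move=> Op Sup Svp; have := Hdiv p Op; rewrite !div_Nfield; apply.
  by case; [exact (not_Sing Sup)|exact (not_Sing Svp)].
(* At singular points one of the vectors is zero and both sides vanish; elsewhere both are multiples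
   of one unit normal. *)
have par q : Omega q -> 0 < w q -> forall i j, cgrad v i q * cgrad u j q = cgrad v j q * cgrad u i q.
  move=> Oq wq i j.
  have zero (g : 'I_(2 * m) -> 'rV[R]_(2 * m) -> R) : ~ 0 < sqnorm g q -> forall k, g k q = 0.
    by move=> g0 k; apply/eqP/negPn/negP => gk; apply: g0; apply: sqnorm_gt0; exists k.
  have [Su|/zero gu0] := pselect (0 < sqnorm (cgrad u) q); last by rewrite !gu0 !mulr0.
  have [Sv|/zero gv0] := pselect (0 < sqnorm (cgrad v) q); last by rewrite !gv0 !mul0r.
  have Neq : forall i, normal (cgrad u) i q = normal (cgrad v) i q.
    exact (normals_eq oO Cw Cgu Cgv dw L0 HL' cK rku rkv Hdiv' Oq wq Su Sv).
  have gE (g : 'I_(2 * m) -> 'rV[R]_(2 * m) -> R) k : 0 < sqnorm g q ->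
      g k q = Num.sqrt (sqnorm g q) * normal g k q.
    by move=> Sg; rewrite /normal mulVKf// gt_eqF// sqrtr_gt0.
  rewrite (gE _ i Sv) (gE _ j Su) (gE _ j Sv) (gE _ i Su) !Neq.
  by rewrite mulrACA [RHS]mulrACA [X in _ * X]mulrC.
have oU : open [set p | Omega p /\ 0 < w p] by apply: open_superlevel => // p; exact: C1_cont.
have dw0 q j : Omega q -> 0 < w q -> partial w j q = 0.
  move=> Oq wq; rewrite dw//; have [i [ij1 ij2 ij3]] := disjoint_pair j m2.
  have UO : [set p | Omega p /\ 0 < w p] `<=` Omega by move=> p [].
  have Uq : [set p | Omega p /\ 0 < w p] q by [].
  pose W i p := cgrad u i p - cgrad v i p; rewrite -/(W j q).
  have CW l := C1_sub UO (C1_B oO (Cgu l) (Cgv l)).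
  (* The pair [i], [partner i] misses that of [j], so of the three curls only the one on [i],
     [partner i] is nonzero and it isolates [W j]. *)
  apply: (@parallel_closed_eq0 _ _ _ (cgrad v) W q i j (partner i) oU (fun l => C1_sub UO (Cgv l)) CW Uq).
  - by move=> p [Op wp] a b; rewrite /W !mulrBr (par p Op wp a b) (mulrC (cgrad v a p) (cgrad v b p)).
  (* [W] is closed because [cgrad u] and [cgrad v] have the same curl. *)
  - move=> a b; rewrite /curl /W (partialB b (Cgu a) (Cgv a) Oq) (partialB a (Cgu b) (Cgv b) Oq).
    have sw (x y z t : R) : x - y - (z - t) = (x - z) - (y - t) by ring.
    have ccu := curl_cgrad a b oO Cu Oq; have ccv := curl_cgrad a b oO Cv Oq.
    by rewrite sw [X in X - _]ccu [X in _ - X]ccv subrr.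
  - rewrite (curl_cgrad _ _ oO Cv Oq) eqxx; case: ifP => _; by rewrite ?oppr_eq0 pnatr_eq0.
  - by rewrite (curl_cgrad _ _ oO Cv Oq) partnerK (negbTE ij2).
  - by rewrite (curl_cgrad _ _ oO Cv Oq) eq_sym (negbTE ij3).
move=> p Op; rewrite -subr_le0 leNgt; apply/negP => wp.
have i0 : 'I_(2 * m) by apply: (@Ordinal _ 0); lia.
have wp0 : 0 < w p by [].
(* The level is [w p] itself, positive by assumption, so that [p] lies in the compact superlevel
   set. *)
apply: (locally_constant_compact_superlevel (i := i0) oO Cw (cK _ wp0) _ Op (lexx _)) => q Oq wq.
have : \forall x \near q, [set p | Omega p /\ 0 < w p] x.
  by apply: open_nbhs_nbhs; split => //; split => //; exact: lt_le_trans wq.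
by apply: filterS => x [Ox wx]; exact: dw0.
Qed.
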